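(* Let $\mathcal{M},\mathcal{N}\subset\mathbb{R}^n$ be two manifolds that are $\mathcal{C}^k$-smooth ($k\geq 2$) around a point $\bar{x}\in\mathcal{M}\cap\mathcal{N}$, such that $\mathcal{M}\cap\mathcal{N}$ is a $\mathcal{C}^k$-smooth manifold around $\bar{x}$ and $\mathrm{T}_{\mathcal{M}\cap\mathcal{N}}(\bar{x})=\mathrm{T}_{\mathcal{M}}(\bar{x})\cap\mathrm{T}_{\mathcal{N}}(\bar{x})$. Let the initial point $x_0$ be close enough to $\bar{x}$, and let $S=(1-\alpha)I+\alpha\,\Pi^{\alpha_2}_{\mathcal{M}}\Pi^{\alpha_1}_{\mathcal{N}}$ with parameters satisfying $\alpha\in(0,1]$, $\alpha_1,\alpha_2\in(0,2]$ and either (B1) $\alpha_1,\alpha_2\in(0,2)$, or (B2) $\alpha\in(0,1)$ with $\alpha_1\neq 2$ or $\alpha_2\neq 2$. Further assume that the same regularity conditions (both manifolds $\mathcal{C}^k$-smooth, $k\geq2$, the intersection a $\mathcal{C}^k$ manifold, and the tangent space of the intersection equal to the intersection of tangent spaces) hold at the limit point $x^*$ of the sequence $(x_k)_{k\in\mathbb{N}}$ generated by $x_{k+1}=Sx_k$. Then for every $\mu_{x^*}\in(\gamma(S_{\mathrm{T}(x^* )}),1)$ there exists $N\in\mathbb{N}$ such that for all $k\geq N$ \[ \|x_k-x^*\|\leq\mu_{x^*}^k, \] or equivalently \[ \limsup_{k\to\infty}\|x_k-x^*\|^{1/k}\leq\gamma(S_{\mathrm{T}(x^* )}). \]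
   Context: For a closed nonempty set $C$, $\Pi_C$ is the projection and $\Pi_C^{\alpha}\coloneqq(1-\alpha)I+\alpha\Pi_C$ the relaxed projection. $S_{\mathrm{T}(x^* )}\coloneqq(1-\alpha)I+\alpha\,\Pi^{\alpha_2}_{\mathrm{T}_{\mathcal{M}}(x^* )}\Pi^{\alpha_1}_{\mathrm{T}_{\mathcal{N}}(x^* )}$. For a matrix $A$ with spectral radius at most 1, $\gamma(A)\coloneqq\max\{|\lambda|\mid\lambda\in\{0\}\cup\Lambda(A)\setminus\{1\}\}$, with $\Lambda(A)$ the set of eigenvalues. *)

(* Defs.v *)
From HB Require Import structures.
From mathcomp Require Import all_boot all_order all_algebra.
From mathcomp Require Import all_classical all_reals all_analysis.
From mathcomp Require Import complex.
Set Implicit Arguments. Unset Strict Implicit. Unset Printing Implicit Defensive.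
Import Order.TTheory GRing.Theory Num.Theory.
Import numFieldNormedType.Exports.
Local Open Scope classical_set_scope.
Local Open Scope ring_scope.

Section Defs.
Variable R : realType.

Definition enorm n (x : 'rV[R]_n) : R := Num.sqrt (\sum_(i < n) x ord0 i ^+ 2).

Fixpoint Ck (k : nat) n m (U : set 'rV[R]_n) (f : 'rV[R]_n -> 'rV[R]_m) : Prop :=
  match k with
  | 0 => forall x, U x -> {for x, continuous f}
  | k'.+1 => (forall x, U x -> differentiable f x) /\
             (forall i : 'I_n, Ck k' U (fun x => 'd f x (delta_mx 0 i)))
  end.

Definition local_defining (k n m : nat) (M : set 'rV[R]_n) (x : 'rV[R]_n)
    (U : set 'rV[R]_n) (F : 'rV[R]_n -> 'rV[R]_m) : Prop :=
  [/\ open U, U x, M x, Ck k U F &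
      (row_full ('J F x) /\ M `&` U = [set y | U y /\ F y = 0])].

Definition Ck_manifold_around (k n : nat) (M : set 'rV[R]_n) (x : 'rV[R]_n) : Prop :=
  exists m (U : set 'rV[R]_n) (F : 'rV[R]_n -> 'rV[R]_m), local_defining k M x U F.

(* Tangent space T_M(x) = ker DF(x) for a local defining function F
   (independent of the choice of F). *)
Definition tangent_space (k n : nat) (M : set 'rV[R]_n) (x : 'rV[R]_n) : set 'rV[R]_n :=
  [set v | exists m (U : set 'rV[R]_n) (F : 'rV[R]_n -> 'rV[R]_m),
             local_defining k M x U F /\ 'd F x v = 0].

Definition proj_set n (C : set 'rV[R]_n) (x : 'rV[R]_n) : set 'rV[R]_n :=
  [set p | C p /\ forall c, C c -> enorm (x - p) <= enorm (x - c)].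

Definition relax_proj n (a : R) (C : set 'rV[R]_n) (x : 'rV[R]_n) : set 'rV[R]_n :=
  [set (1 - a) *: x + a *: p | p in proj_set C x].

Definition S_op n (alpha alpha1 alpha2 : R) (M N : set 'rV[R]_n) (x : 'rV[R]_n)
    : set 'rV[R]_n :=
  [set (1 - alpha) *: x + alpha *: z | z in
     \bigcup_(y in relax_proj alpha1 N x) relax_proj alpha2 M y].

Definition is_proj_mx n (C : set 'rV[R]_n) (P : 'M[R]_n) : Prop :=
  forall v, proj_set C v (v *m P).

(* Matrix of S_T = (1-alpha) I + alpha Pi^{alpha2}_{T_M} Pi^{alpha1}_{T_N}
   in row-vector convention (first apply the N-part, then the M-part). *)
Definition S_T_mx n (alpha alpha1 alpha2 : R) (PM PN : 'M[R]_n) : 'M[R]_n :=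
  (1 - alpha)%:M + alpha *: (((1 - alpha1)%:M + alpha1 *: PN) *m
                             ((1 - alpha2)%:M + alpha2 *: PM)).

Definition gamma n (A : 'M[R]_n) : R :=
  sup [set r : R | exists l : R[i],
         (l = 0 \/ (eigenvalue (map_mx (fun a : R => (a%:C)%C) A) l /\ l != 1)) /\
         r = Normc.normc l].

Definition regular_at (k n : nat) (M N : set 'rV[R]_n) (p : 'rV[R]_n) : Prop :=
  [/\ Ck_manifold_around k M p, Ck_manifold_around k N p,
      Ck_manifold_around k (M `&` N) p &
      tangent_space k (M `&` N) p = tangent_space k M p `&` tangent_space k N p].

End Defs.

(* Main.v *)
Require Import Defs.
From HB Require Import structures.
From mathcomp Require Import all_boot all_order all_algebra.
From mathcomp Require Import all_classical all_reals all_analysis.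
From mathcomp Require Import complex.
From mathcomp Require Import ring lra.
Import Order.TTheory GRing.Theory Num.Theory.
Import numFieldNormedType.Exports.
Local Open Scope classical_set_scope.
Local Open Scope ring_scope.
Set Implicit Arguments. Unset Strict Implicit. Unset Printing Implicit Defensive.

(** A direct argument at the limit point [xs], which lies in both manifolds.
    First-order optimality gives [u - p = l *m (J p)^T] for a nearest point [p] of [u];
    comparing two such identities and using that the Jacobian is Lipschitz shows that
    the (set-valued) projection is strictly differentiable at [xs], with derivative the
    orthogonal projection onto the tangent space. Hence so is [S], with derivative [S_T].

    As 1 may be an eigenvalue of [S_T], one works with the steps [x (k+1) - x k] instead
    of the errors. Points of the intersection are fixed by [S], and every [z] near [xs]
    has a point [y] of the intersection with [z - y] orthogonal to its tangent space [T].
    Therefore a step is, up to a relative error tending to 0, orthogonal to [T], and it is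
    mapped to the next one by [B = S_T - P_T], whose eigenvalues are 0 or eigenvalues of
    [S_T] other than 1. A norm adapted to [B] makes the steps decay geometrically, and
    summing them gives the rate. *)

(** * Matrix norms and orthogonal projections onto kernels *)

Section MatrixNorm.
Variable R : realType.

Lemma mx_entry_le m n (A : 'M[R]_(m, n)) i j : `|A i j| <= `|A|.
Proof.
by rewrite [leRHS]/Num.norm /= mx_normrE; apply/bigmax_geP; right => /=; exists (i, j).
Qed.

Lemma mx_norm_le m n (A : 'M[R]_(m, n)) (c : R) :
  0 <= c -> (forall i j, `|A i j| <= c) -> `|A| <= c.
Proof.
move=> c0 Ac; rewrite [leLHS]/Num.norm /= mx_normrE.
by apply/bigmax_leP; split => // -[i j] _; exact: Ac.
Qed.

Lemma mx_norm_mul m n p (A : 'M[R]_(m, n)) (B : 'M[R]_(n, p)) :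
  `|A *m B| <= n%:R * `|A| * `|B|.
Proof.
apply: mx_norm_le => [|i j]; first by rewrite !mulr_ge0.
rewrite mxE; apply: le_trans (ler_norm_sum _ _ _) _.
apply: (@le_trans _ _ (\sum_(k < n) `|A| * `|B|)).
  by apply: ler_sum => k _; rewrite normrM ler_pM// mx_entry_le.
by rewrite sumr_const card_ord -mulrA mulr_natl.
Qed.

Lemma mulmx_bounded n p (B : 'M[R]_(n, p)) :
  exists2 K : R, 0 < K & forall m (A : 'M[R]_(m, n)), `|A *m B| <= K * `|A|.
Proof.
exists (1 + n%:R * `|B|); first by rewrite ltr_pwDl// mulr_ge0.
move=> m A; apply: le_trans (mx_norm_mul A B) _.
by rewrite mulrAC ler_wpM2r// lerDr.
Qed.

Lemma mx_norm_tr m n (A : 'M[R]_(m, n)) : `|A^T| = `|A|.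
Proof.
suff le_tr p q (B : 'M[R]_(p, q)) : `|B^T| <= `|B|.
  by apply/eqP; rewrite eq_le le_tr -[A in X in X <= _]trmxK le_tr.
by apply: mx_norm_le => // i j; rewrite mxE mx_entry_le.
Qed.

End MatrixNorm.

Section EuclideanNorm.
Variable R : realType.

Definition dotv n (u v : 'rV[R]_n) : R := (u *m v^T) 0 0.

Lemma dotvE n (u v : 'rV[R]_n) : dotv u v = \sum_i u 0 i * v 0 i.
Proof. by rewrite /dotv mxE; apply: eq_bigr => i _; rewrite mxE. Qed.

Lemma dotvC n (u v : 'rV[R]_n) : dotv u v = dotv v u.
Proof. by rewrite !dotvE; apply: eq_bigr => i _; rewrite mulrC. Qed.

Lemma dotvDl n (u v w : 'rV[R]_n) : dotv (u + v) w = dotv u w + dotv v w.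
Proof. by rewrite /dotv mulmxDl mxE. Qed.

Lemma dotvDr n (u v w : 'rV[R]_n) : dotv w (u + v) = dotv w u + dotv w v.
Proof. by rewrite !(dotvC w) dotvDl. Qed.

Lemma dotvZl n a (u w : 'rV[R]_n) : dotv (a *: u) w = a * dotv u w.
Proof. by rewrite /dotv -scalemxAl mxE. Qed.

Lemma dotvZr n a (u w : 'rV[R]_n) : dotv w (a *: u) = a * dotv w u.
Proof. by rewrite !(dotvC w) dotvZl. Qed.

Lemma dotvNl n (u w : 'rV[R]_n) : dotv (- u) w = - dotv u w.
Proof. by rewrite -scaleN1r dotvZl mulN1r. Qed.

Lemma dotvNr n (u w : 'rV[R]_n) : dotv w (- u) = - dotv w u.
Proof. by rewrite !(dotvC w) dotvNl. Qed.

Lemma dotv_ge0 n (u : 'rV[R]_n) : 0 <= dotv u u.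
Proof. by rewrite dotvE sumr_ge0// => i _; rewrite -expr2 sqr_ge0. Qed.

Lemma dotv_eq0 n (u : 'rV[R]_n) : dotv u u = 0 -> u = 0.
Proof.
rewrite dotvE => /eqP; rewrite psumr_eq0; last first.
  by move=> i _; rewrite -expr2 sqr_ge0.
move=> /allP u0; apply/rowP => i; rewrite mxE; apply/eqP.
by have := u0 i (mem_index_enum _); rewrite -expr2 sqrf_eq0.
Qed.

Lemma dotv_sub n (u v : 'rV[R]_n) :
  dotv (u - v) (u - v) = dotv u u - 2 * dotv u v + dotv v v.
Proof. by rewrite !(dotvDl, dotvDr, dotvNl, dotvNr) (dotvC v u); ring. Qed.

Lemma enormE n (u : 'rV[R]_n) : enorm u = Num.sqrt (dotv u u).
Proof.
by congr Num.sqrt; rewrite dotvE; apply: eq_bigr => i _; rewrite expr2.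
Qed.

Lemma enorm_le n (u v : 'rV[R]_n) :
  (enorm u <= enorm v) = (dotv u u <= dotv v v).
Proof. by rewrite !enormE ler_sqrt// dotv_ge0. Qed.

Lemma dotv_norm n (u v : 'rV[R]_n) : `|dotv u v| <= n%:R * `|u| * `|v|.
Proof.
by apply: le_trans (mx_entry_le _ _ _) _; rewrite -(mx_norm_tr v) mx_norm_mul.
Qed.

Lemma mx_norm_enorm n (u : 'rV[R]_n) : `|u| <= enorm u.
Proof.
apply: mx_norm_le => [|i j]; first exact: sqrtr_ge0.
rewrite ord1 enormE -sqrtr_sqr ler_sqrt ?dotv_ge0// dotvE (bigD1 j)//= -expr2.
by rewrite lerDl sumr_ge0// => k _; rewrite -expr2 sqr_ge0.
Qed.

Lemma enorm_mx_norm n (u : 'rV[R]_n) : enorm u <= n%:R * `|u|.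
Proof.
rewrite -[leRHS]ger0_norm ?mulr_ge0// -sqrtr_sqr enormE ler_sqrt ?sqr_ge0//.
apply: le_trans (ler_norm _) (le_trans (dotv_norm _ _) _).
case: n u => [|n] u; first by rewrite !mul0r expr0n.
rewrite exprMn -mulrA -expr2 ler_wpM2r ?sqr_ge0//.
by rewrite expr2 ler_peMl// ler1n.
Qed.

End EuclideanNorm.

Section KernelProjection.
Variable R : realType.
Variables (n m : nat) (A : 'M[R]_(n, m)).

(** The Moore-Penrose left inverse when the columns of [A] are independent. With row vectors,
    [kproj] is then the orthogonal projection onto the kernel of [v |-> v *m A]. *)
Definition lpinv : 'M[R]_(m, n) := invmx (A^T *m A) *m A^T.
Definition kproj : 'M[R]_n := 1%:M - A *m lpinv.

(** If the Gram matrix kills [v], then |v A^T|^2 = v A^T A v^T = 0, and [A^T] is row free. *)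
Lemma gram_unit : row_full A -> A^T *m A \in unitmx.
Proof.
move=> fA; rewrite -row_free_unit -kermx_eq0; apply/eqP/row_matrixP => i.
rewrite row0; set v := row i _.
have : v *m (A^T *m A) = 0 by rewrite -row_mul mulmx_ker row0.
move=> vAA; have : dotv (v *m A^T) (v *m A^T) = 0.
  by rewrite /dotv trmx_mul trmxK !mulmxA -[v *m _ *m A]mulmxA vAA mul0mx mxE.
move=> /dotv_eq0 vA; apply/eqP.
have fAT : row_free A^T by rewrite /row_free mxrank_tr.
by rewrite -(mulmx_free_eq0 _ fAT) vA.
Qed.

Hypothesis fA : row_full A.

Lemma mul_lpinv : lpinv *m A = 1%:M.
Proof. by rewrite -mulmxA mulVmx// gram_unit. Qed.

Lemma kproj_mul : kproj *m A = 0.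
Proof. by rewrite mulmxBl mul1mx -mulmxA mul_lpinv mulmx1 subrr. Qed.

Lemma lpinv_kproj : lpinv *m kproj = 0.
Proof. by rewrite mulmxBr mulmx1 mulmxA mul_lpinv mul1mx subrr. Qed.

Lemma kproj_id (v : 'rV[R]_n) : v *m A = 0 -> v *m kproj = v.
Proof. by move=> vA; rewrite mulmxBr mulmx1 mulmxA vA mul0mx subr0. Qed.

Lemma trmx_kproj : kproj^T = kproj.
Proof.
rewrite linearB /= trmx1 trmx_mul trmx_mul trmxK trmx_inv trmx_mul trmxK.
by rewrite -mulmxA.
Qed.

Lemma trmx_mul_kproj : A^T *m kproj = 0.
Proof. by apply: trmx_inj; rewrite trmx_mul trmx_kproj trmxK kproj_mul trmx0. Qed.

Lemma kproj_idem : kproj *m kproj = kproj.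
Proof. by rewrite [LHS]mulmxBl mul1mx -mulmxA lpinv_kproj mulmx0 subr0. Qed.

Lemma dotv_kproj (u v : 'rV[R]_n) : dotv (u *m kproj) v = dotv u (v *m kproj).
Proof. by rewrite /dotv trmx_mul trmx_kproj mulmxA. Qed.

(** Since [e - e *m kproj] is orthogonal to the kernel, Pythagoras makes every other point of the
    kernel strictly farther from [e]; basis vectors [e] then determine [P]. *)
Lemma is_proj_mx_kproj (P : 'M[R]_n) :
  is_proj_mx [set v | v *m A = 0] P -> P = kproj.
Proof.
move=> isP; apply/row_matrixP => i; rewrite -[in LHS](mulmx1 P) -[kproj]mulmx1.
set e := delta_mx 0 i : 'rV[R]_n; rewrite !mulmx1 !rowE -/e.
have [/= eP emin] := isP e.
have := emin (e *m kproj); rewrite /= -mulmxA kproj_mul mulmx0 => /(_ erefl).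
rewrite enorm_le; set q := e *m kproj; set p := e *m P.
have qp : (q - p) *m kproj = q - p.
  by rewrite mulmxBl (kproj_id eP) /q -mulmxA kproj_idem.
have o : dotv (e - q) (q - p) = 0.
  rewrite -qp -dotv_kproj mulmxBl /q -mulmxA kproj_idem subrr.
  by rewrite /dotv mul0mx mxE.
have -> : e - p = (e - q) + (q - p) by rewrite addrA subrK.
move: o; move: (e - q) => a; have [->//|qNp] := eqVneq p q.
have : q - p != 0 by rewrite subr_eq0 eq_sym.
move: (q - p) => b b0 ab.
rewrite dotvDl !dotvDr (dotvC b a) ab !(addr0, add0r) -[leRHS]addr0 lerD2l => le0.
case/eqP: b0; apply: dotv_eq0.
by apply/eqP; rewrite eq_le le0 dotv_ge0.
Qed.

End KernelProjection.

(** * A norm adapted to the spectral radius *)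

Section AdaptedNorm.
Variable R : realType.
Local Notation C := (R[i]).
Local Notation normc := Normc.normc.

Definition norm1 n (w : 'rV[C]_n) : R := \sum_i normc (w 0 i).

Lemma normc_ge0 (z : C) : 0 <= normc z.
Proof. by case: z => a b; rewrite /normc sqrtr_ge0. Qed.

Lemma normc_real (a : R) : normc (a%:C)%C = `|a|.
Proof. by rewrite /normc /= expr0n addr0 sqrtr_sqr. Qed.

Lemma norm1_ge0 n (w : 'rV[C]_n) : 0 <= norm1 w.
Proof. by apply: sumr_ge0 => i _; exact: normc_ge0. Qed.

Lemma norm1D n (u v : 'rV[C]_n) : norm1 (u + v) <= norm1 u + norm1 v.
Proof. by rewrite -big_split ler_sum// => i _; rewrite mxE le_normcD. Qed.

Lemma norm1Z n a (u : 'rV[C]_n) : norm1 (a *: u) = normc a * norm1 u.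
Proof. by rewrite mulr_sumr; apply: eq_bigr => i _; rewrite mxE Normc.normcM. Qed.

Lemma norm10 n : norm1 (0 : 'rV[C]_n) = 0.
Proof. by rewrite -(scale0r 0) norm1Z Normc.normc0 mul0r. Qed.

Variables (n : nat) (B : 'M[C]_n) (c : R).

(** A sum of the norms of w, w (B - r1), w (B - r1)(B - r2), ... with weights 1, c, c^2, ... It
    stands for a norm in a rescaled basis making [B] triangular: on each term [B] acts as [r] plus
    the next term, whose weight is larger by the factor [c]. *)
Fixpoint triang_norm (rs : seq C) (w : 'rV[C]_n) : R :=
  if rs is r :: rs' then norm1 w + c * triang_norm rs' (w *m B - r *: w) else 0.

Fixpoint killed (rs : seq C) (w : 'rV[C]_n) : Prop :=
  if rs is r :: rs' then killed rs' (w *m B - r *: w) else w = 0.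

Hypothesis c0 : 0 < c.

Lemma triang_norm_ge0 rs w : 0 <= triang_norm rs w.
Proof.
elim: rs w => //= r rs IH w.
by rewrite addr_ge0 ?norm1_ge0// mulr_ge0// ltW.
Qed.

Lemma triang_normD rs u v :
  triang_norm rs (u + v) <= triang_norm rs u + triang_norm rs v.
Proof.
elim: rs u v => [|r rs IH] u v /=; first by rewrite addr0.
rewrite addrACA lerD ?norm1D// -mulrDr ler_wpM2l ?(ltW c0)//.
by rewrite mulmxDl scalerDr opprD addrACA IH.
Qed.

Lemma triang_normZ rs a u : triang_norm rs (a *: u) = normc a * triang_norm rs u.
Proof.
elim: rs u => [|r rs IH] u /=; first by rewrite mulr0.
rewrite norm1Z -scalemxAl scalerA (mulrC r) -scalerA -scalerBr IH.
by rewrite mulrDr mulrCA.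
Qed.

Lemma norm1_triang rs w : killed rs w -> norm1 w <= triang_norm rs w.
Proof.
case: rs => [|r rs] /=; first by move=> ->; rewrite norm10.
by move=> _; rewrite lerDl mulr_ge0 ?triang_norm_ge0// ltW.
Qed.

(** With w' = w B - r w one has |w B| <= g |w| + |w'|. The extra |w'| cancels against the norm
    subtracted in the induction hypothesis for w', so the subtracted [norm1 w] is what closes the
    induction. *)
Lemma triang_norm_mul rs g w : (forall r, r \in rs -> normc r <= g) ->
  killed rs w ->
  triang_norm rs (w *m B) <=
    g * triang_norm rs w + c^-1 * (triang_norm rs w - norm1 w).
Proof.
elim: rs w => [|r rs IH] w rsg /=.
  by move=> ->; rewrite norm10 subr0 !mulr0 addr0.
set w' := w *m B - r *: w => kw'.
have /IH/(_ kw') := fun s (sr : s \in rs) => rsg s (mem_behead (s := r :: rs) sr).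
have -> : w *m B *m B - r *: (w *m B) = w' *m B by rewrite mulmxBl scalemxAl.
rewrite -(ler_pM2l c0) mulrDr mulVKf ?gt_eqF// => IHw.
have : norm1 (w *m B) <= g * norm1 w + norm1 w'.
  have -> : w *m B = r *: w + w' by rewrite /w' addrC subrK.
  apply: le_trans (norm1D _ _) _; rewrite norm1Z lerD2r ler_wpM2r ?norm1_ge0//.
  by apply: rsg; rewrite mem_head.
move=> le1; apply: le_trans (lerD le1 IHw) _.
rewrite [norm1 w + _ - _]addrAC subrr add0r mulKf ?gt_eqF//.
rewrite le_eqVlt; apply/orP; left; apply/eqP; ring.
Qed.

End AdaptedNorm.

Lemma killed_horner (R : realType) n (B : 'M[R[i]]_n.+1) rs w :
  w *m horner_mx B (\prod_(z <- rs) ('X - z%:P)) = 0 -> killed B rs w.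
Proof.
elim: rs w => [|r rs IH] w /=.
  by rewrite big_nil rmorph1 mulmx1.
rewrite big_cons rmorphM rmorphB /= horner_mx_X horner_mx_C => kw; apply: IH.
by rewrite -kw -mulmxE mulmxA mulmxBr mul_mx_scalar.
Qed.

Lemma char_poly_roots (R : realType) n (B : 'M[R[i]]_n) :
  {rs : seq R[i] | char_poly B = \prod_(z <- rs) ('X - z%:P) &
    forall z, (z \in rs) = eigenvalue B z}.
Proof.
have [rs rsE] := closed_field_poly_normal (char_poly B).
move: rsE; rewrite (monicP (char_poly_monic B)) scale1r => rsE.
by exists rs => // z; rewrite eigenvalue_root_char rsE root_prod_XsubC.
Qed.

(** By Cayley-Hamilton the roots of the characteristic polynomial form a list that kills every
    vector, so [triang_norm_mul] applies; the weight c = 1 / (mu - g) turns its factor g + 1 / c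
    into mu. *)
Lemma adapted_norm (R : realType) n (B : 'M[R]_n) (g mu : R) :
  (forall r, eigenvalue (map_mx (fun a : R => (a%:C)%C) B) r ->
     Normc.normc r <= g) ->
  g < mu ->
  exists N : 'rV[R]_n -> R,
    [/\ forall u v, N (u + v) <= N u + N v,
        forall v, `|v| <= N v,
        exists2 K, 0 < K & forall v, N v <= K * `|v| &
        forall v, N (v *m B) <= mu * N v].
Proof.
case: n B => [|n] B eig gmu.
  exists (fun=> 0); split=> [u v|v||v]; rewrite ?addr0 ?mulr0//.
    by rewrite thinmx0 normr0.
  by exists 1 => // v; rewrite mul1r.
set Bc := map_mx _ B in eig; pose emb (v : 'rV[R]_n.+1) := map_mx (real_complex R) v.
have [rs rsE rs_eig] := char_poly_roots Bc.
have kill (v : 'rV_n.+1) : killed Bc rs v.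
  by apply: killed_horner; rewrite -rsE Cayley_Hamilton mulmx0.
pose c := (mu - g)^-1; have c0 : 0 < c by rewrite invr_gt0 subr_gt0.
pose N v := triang_norm Bc c rs (emb v).
have Nemb v : `|v| <= norm1 (emb v).
  apply: mx_norm_le => [|i j]; first exact: norm1_ge0.
  rewrite ord1 /norm1 (bigD1 j)//= mxE normc_real lerDl.
  by apply: sumr_ge0 => k _; exact: normc_ge0.
have ND u v : N (u + v) <= N u + N v by rewrite /N /emb map_mxD triang_normD.
exists N; split=> [//|v||v].
- exact: le_trans (Nemb v) (norm1_triang _ (kill _)).
- exists (1 + \sum_i N (delta_mx 0 i)) => [|v].
    by rewrite ltr_pwDl// sumr_ge0// => i _; exact: triang_norm_ge0.
  apply: (@le_trans _ _ (\sum_i N (v 0 i *: delta_mx 0 i))).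
    rewrite {1}(row_sum_delta v); elim/big_ind2: _ => //.
      by rewrite /N /emb map_mx0 -(scale0r 0) triang_normZ Normc.normc0 mul0r.
    by move=> ? ? ? ? h1 h2; apply: le_trans (ND _ _) (lerD h1 h2).
  rewrite mulrDl mul1r ler_wpDl// mulr_suml ler_sum// => i _.
  rewrite /N /emb map_mxZ triang_normZ normc_real mulrC.
  by rewrite ler_wpM2l ?triang_norm_ge0 ?mx_entry_le.
- rewrite /N /emb map_mxM.
  apply: le_trans (triang_norm_mul c0 _ (kill _)) _ => [r|].
    by rewrite rs_eig; exact: eig.
  rewrite /c invrK -/c; set t := triang_norm _ _ _ _; rewrite -/t.
  have -> : mu * t = g * t + (mu - g) * t by ring.
  rewrite lerD2l ler_wpM2l ?subr_ge0 ?(ltW gmu)// gerBl.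
  exact: norm1_ge0.
Qed.

(** The sum of the moduli of the characteristic roots bounds the set in [gamma], so its [sup] is a
    true upper bound and not a default value. *)
Lemma gamma_ge (R : realType) n (A : 'M[R]_n) (r : R[i]) :
  r = 0 \/ eigenvalue (map_mx (fun a : R => (a%:C)%C) A) r /\ r != 1 ->
  Normc.normc r <= gamma A.
Proof.
move=> rA; apply: ub_le_sup; last by exists r.
have [rs _ rs_eig] := char_poly_roots (map_mx (fun a : R => (a%:C)%C) A).
exists (\sum_(z <- rs) Normc.normc z) => _ [z [zP ->]].
have sum0 (s : seq R[i]) : 0 <= \sum_(z <- s) Normc.normc z.
  by apply: sumr_ge0 => i _; exact: normc_ge0.
case: zP => [->|[]]; first by rewrite Normc.normc0.
rewrite -rs_eig => + _; elim: rs {rs_eig} => // y s IH; rewrite in_cons big_cons.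
case/orP => [/eqP ->|/IH zs]; first by rewrite lerDl.
by apply: le_trans zs _; rewrite lerDr normc_ge0.
Qed.

(** * Second-order estimates for C^2 maps *)

Section SecondOrder.
Variable R : realType.

Lemma diff_jacobian n m (f : 'rV[R]_n -> 'rV[R]_m) (a h : 'rV[R]_n) :
  'd f a h = h *m 'J f a.
Proof. by rewrite /jacobian mul_rV_lin1. Qed.

Lemma jacobian_norm_le n m (f : 'rV[R]_n -> 'rV[R]_m) (a b : 'rV[R]_n) (c : R) :
  0 <= c ->
  (forall i, `|'d f a (delta_mx 0 i : 'rV_n) - 'd f b (delta_mx 0 i : 'rV_n)| <= c) ->
  `|'J f a - 'J f b| <= c.
Proof.
move=> c0 h.
have {}h i : `|row i ('J f a - 'J f b)| <= c.
  suff -> : row i ('J f a - 'J f b) =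
    'd f a (delta_mx 0 i : 'rV_n) - 'd f b (delta_mx 0 i : 'rV_n) by exact: h.
  by rewrite rowE mulmxBr; congr (_ - _); rewrite -diff_jacobian.
move: ('J f a - 'J f b) h => A h; apply: mx_norm_le => // i j.
apply: le_trans (h i); apply: le_trans (mx_entry_le _ 0 j).
by rewrite [in leRHS]mxE.
Qed.

Lemma is_derive_segment n m (f : 'rV[R]_n -> 'rV[R]_m) (b h : 'rV[R]_n)
    (t : R) (j : 'I_m) : differentiable f (b + t *: h) ->
  is_derive t 1 (fun s : R => f (b + s *: h) 0 j) (('d f (b + t *: h) h) 0 j).
Proof.
move=> df; have := diff_derivable df (v := h); rewrite -deriveE//.
rewrite /derivable => cf.
have {}cf : (fun s : R => (s^-1 *: (f (s *: h + (b + t *: h)) - f (b + t *: h))) 0 j : R)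
    @ 0^' --> ('D_h f (b + t *: h)) 0 j.
  exact: (cvg_comp _ _ cf (@coord_continuous _ _ _ _ _ _)).
have {}cf : (fun s : R => s^-1 * (f (b + (s * 1 + t) *: h) 0 j - f (b + t *: h) 0 j))
    @ 0^' --> ('D_h f (b + t *: h)) 0 j.
  apply: cvg_trans cf; apply: near_eq_cvg; near=> s.
  by rewrite !mxE mulr1 scalerDl addrCA.
apply: DeriveDef; first by apply/cvg_ex; eexists; exact: cf.
by rewrite /derive; apply: cvg_lim.
Unshelve. all: by end_near. Qed.

Lemma mvt01 (phi dphi : R -> R) :
  (forall t : R, 0 <= t <= 1 -> is_derive t 1 phi (dphi t)) ->
  exists2 c : R, 0 <= c <= 1 & phi 1 - phi 0 = dphi c.
Proof.
move=> dphiP.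
have cphi : {within `[0, 1], continuous phi}.
  apply: derivable_within_continuous => t; rewrite in_itv /= => t01.
  by have [] := dphiP t t01.
have [t|c c01 ->] := @MVT_segment R phi dphi 0 1 ler01 _ cphi.
- by move=> /subset_itv_oo_cc; rewrite in_itv /=; exact: dphiP.
- by exists c; rewrite ?subr0 ?mulr1// -[_ <= _ <= _]in_itv.
Qed.

(** The mean value theorem is used on each coordinate. The intermediate point depends on the
    coordinate, which costs nothing in the sup norm. Taking v = 0 yields Lipschitz bounds, and v = h
    J(b) yields Taylor bounds. *)
Lemma segment_mvt n m (f : 'rV[R]_n -> 'rV[R]_m) (b h : 'rV[R]_n)
    (v : 'rV[R]_m) (C : R) :
  (forall t : R, 0 <= t <= 1 -> differentiable f (b + t *: h) /\
     `|'d f (b + t *: h) h - v| <= C) ->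
  `|f (b + h) - f b - v| <= C.
Proof.
move=> df.
have C0 : 0 <= C by have [|_] := df 0; [rewrite lexx ler01|exact: le_trans].
apply: mx_norm_le => // i j; rewrite ord1.
pose phi (s : R) : R := f (b + s *: h) 0 j.
pose dphi (t : R) : R := ('d f (b + t *: h) h) 0 j.
have [t t01|c c01] := @mvt01 phi dphi.
  by apply: is_derive_segment; exact: (df t t01).1.
rewrite /phi scale1r scale0r addr0 => eqc.
have [_] := df c c01; apply: le_trans; rewrite -[leRHS]/(`|_ - v|).
by apply: le_trans (mx_entry_le _ 0 j); rewrite !mxE eqc.
Qed.

Lemma ball_segment n (x a b : 'rV[R]_n) (d t : R) : 0 <= t <= 1 ->
  `|a - x| < d -> `|b - x| < d -> `|b + t *: (a - b) - x| < d.
Proof.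
move=> /andP[t0 t1] ax bx.
have -> : b + t *: (a - b) - x = t *: (a - x) + (1 - t) *: (b - x).
  by apply/rowP => i; rewrite !mxE; ring.
apply: le_lt_trans (ler_normD _ _) _; rewrite !normrZ !ger0_norm ?subr_ge0//.
have [->|tN0] := eqVneq t 0; first by rewrite mul0r add0r subr0 mul1r.
have tp : 0 < t by rewrite lt_neqAle eq_sym tN0.
rewrite -[ltRHS](_ : t * d + (1 - t) * d = d); last by ring.
by rewrite ltr_leD// ?ltr_pM2l// ler_wpM2l ?subr_ge0// ltW.
Qed.

Lemma diff_lipschitz n m (g : 'rV[R]_n -> 'rV[R]_m) x (d K : R) :
  0 <= K ->
  (forall y, `|y - x| < d -> differentiable g y /\
     forall j, `|'d g y (delta_mx 0 j : 'rV_n)| <= K) ->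
  forall a b, `|a - x| < d -> `|b - x| < d -> `|g a - g b| <= n%:R * K * `|a - b|.
Proof.
move=> K0 dg a b ad bd.
have := @segment_mvt _ _ g b (a - b) 0 (n%:R * K * `|a - b|).
rewrite subr0 [b + _]addrC subrK; apply => t t01.
have [dgy hy] := dg _ (ball_segment t01 ad bd); split=> //.
move: ('d g _) hy => D hy; rewrite subr0 [X in D X]row_sum_delta linear_sum /=.
apply: le_trans (ler_norm_sum _ _ _) _.
apply: (@le_trans _ _ (\sum_(j < n) K * `|a - b|)).
  by apply: ler_sum => j _; rewrite linearZ /= normrZ mulrC ler_pM// mx_entry_le.
by rewrite sumr_const card_ord -mulrA mulr_natl.
Qed.

Lemma jacobian_lipschitz_quadratic n m (F : 'rV[R]_n -> 'rV[R]_m) x (d K : R) :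
  0 <= K ->
  (forall y, `|y - x| < d -> differentiable F y) ->
  (forall a b, `|a - x| < d -> `|b - x| < d -> `|'J F a - 'J F b| <= K * `|a - b|) ->
  forall a b, `|a - x| < d -> `|b - x| < d ->
    `|F a - F b - (a - b) *m 'J F b| <= n%:R * K * `|a - b| ^+ 2.
Proof.
move=> K0 dF JL a b ad bd.
have := @segment_mvt _ _ F b (a - b) ((a - b) *m 'J F b) (n%:R * K * `|a - b| ^+ 2).
rewrite [b + _]addrC subrK; apply => t t01.
have yd := ball_segment t01 ad bd; split; first exact: dF.
rewrite diff_jacobian -mulmxBr; apply: le_trans (mx_norm_mul _ _) _.
rewrite expr2 mulrA [_ * K * _]mulrAC -[leRHS]mulrA ler_wpM2l ?mulr_ge0//.
apply: le_trans (JL _ _ yd bd) _.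
rewrite ler_wpM2l// addrAC subrr add0r normrZ.
by case/andP: t01 => t0 t1; rewrite ger0_norm// ler_piMl.
Qed.

Definition second_order_at n m (F : 'rV[R]_n -> 'rV[R]_m) (x : 'rV[R]_n) :=
  exists2 d : R, 0 < d & exists2 K : R, 0 < K &
    forall a b, `|a - x| < d -> `|b - x| < d ->
      `|'J F a - 'J F b| <= K * `|a - b| /\
      `|F a - F b - (a - b) *m 'J F b| <= K * `|a - b| ^+ 2.

Lemma Ck_continuous k n m (U : set 'rV[R]_n) (f : 'rV[R]_n -> 'rV[R]_m) x :
  Ck k U f -> U x -> {for x, continuous f}.
Proof.
case: k => [|k] /= => [fc Ux|[df _] Ux]; first exact: fc.
exact/differentiable_continuous/df.
Qed.

Lemma ler_sum2 n (f : 'I_n -> 'I_n -> R) i j : (forall i j, 0 <= f i j) ->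
  f i j <= \sum_i \sum_j f i j.
Proof.
move=> f0; rewrite (bigD1 i)//= (bigD1 j)//= -addrA lerDl addr_ge0//.
  by apply: sumr_ge0.
by apply: sumr_ge0 => l _; exact: sumr_ge0.
Qed.

Lemma near_bounded n m (h : 'I_n -> 'I_n -> 'rV[R]_n -> 'rV[R]_m) x :
  (forall i j, {for x, continuous (h i j)}) ->
  exists2 K : R, 0 <= K & \forall y \near x, forall i j, `|h i j y| <= K.
Proof.
move=> hc; pose f i j := `|h i j x| + 1.
have f0 i j : 0 <= f i j by rewrite addr_ge0.
exists (\sum_i \sum_j f i j).
  by apply: sumr_ge0 => i _; apply: sumr_ge0.
suff hij i j : \forall y \near x, `|h i j y| <= \sum_i \sum_j f i j.
  set K := \sum_i _ in hij *.
  have hi i : nbhs x [set y | forall j, `|h i j y| <= K].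
    exact: (@filter_forall _ _ (fun j => [set y | `|h i j y| <= K]) _ _ (hij i)).
  exact: (@filter_forall _ _ (fun i => [set y | forall j, `|h i j y| <= K]) _ _ hi).
have := hc i j => /cvgrPdist_lt/(_ _ ltr01); apply: filterS => y /ltW hy.
apply: le_trans (ler_sum2 i j f0).
by rewrite -lerBlDl; apply: le_trans hy; rewrite distrC; exact: lerB_dist.
Qed.

(** The second partial derivatives are continuous, hence bounded near [x]. One use of the mean value
    inequality makes the Jacobian Lipschitz, a second one gives the quadratic Taylor remainder. *)
Lemma Ck_second_order k n m (U : set 'rV[R]_n) (F : 'rV[R]_n -> 'rV[R]_m) x :
  (2 <= k)%N -> open U -> U x -> Ck k U F -> second_order_at F x.
Proof.
case: k => [|[|k]]// _ oU Ux [dF dg].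
have hc i j : {for x, continuous
    (fun y => 'd (fun z => 'd F z (delta_mx 0 i : 'rV_n)) y (delta_mx 0 j : 'rV_n))}.
  exact: (Ck_continuous ((dg i).2 j)).
have [K0 K00 hK] := near_bounded hc.
have : \forall y \near x, U y /\ forall i j,
    `|'d (fun z => 'd F z (delta_mx 0 i : 'rV_n)) y (delta_mx 0 j : 'rV_n)| <= K0.
  by apply: filterI => //; exact: open_nbhs_nbhs.
move=> /nbhs_ballP[d /= d0 dP].
have {}dP y : `|y - x| < d -> U y /\ forall i j,
    `|'d (fun z => 'd F z (delta_mx 0 i : 'rV_n)) y (delta_mx 0 j : 'rV_n)| <= K0.
  by move=> yx; apply: dP; rewrite -ball_normE /= distrC.
have JL a b : `|a - x| < d -> `|b - x| < d ->
    `|'J F a - 'J F b| <= n%:R * K0 * `|a - b|.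
  move=> ad bd; apply: jacobian_norm_le => [|i]; first by rewrite !mulr_ge0.
  apply: (@diff_lipschitz _ _ (fun z => 'd F z (delta_mx 0 i : 'rV_n)) x d K0 K00 _ a b ad bd).
  by move=> y yd; split; [exact: ((dg i).1 y (dP y yd).1)|exact: (dP y yd).2].
have K10 : 0 <= n%:R * K0 by rewrite mulr_ge0.
exists d => //; exists (n%:R * K0 + n%:R * (n%:R * K0) + 1).
  by rewrite ltr_wpDl// addr_ge0// mulr_ge0.
move=> a b ad bd; split.
  by apply: le_trans (JL _ _ ad bd) _; rewrite ler_wpM2r// -addrA lerDl addr_ge0// mulr_ge0.
apply: le_trans (jacobian_lipschitz_quadratic K10 (fun y yd => dF y (dP y yd).1) JL ad bd) _.
by rewrite ler_wpM2r ?sqr_ge0// addrAC lerDr addr_ge0.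
Qed.

End SecondOrder.

(** * Projection onto a regular zero set *)

Section ApproximateIdentity.
Variable R : realType.

Lemma closed_norm_ball_compact m (r : R) : compact [set w : 'rV[R]_m | `|w| <= r].
Proof.
apply: bounded_closed_compact.
  exists r; split=> [|M rM w /= /le_trans->//]; [exact: num_real|exact: ltW].
apply: (@closed_comp _ _ (fun w : 'rV[R]_m => `|w|) [set y | y <= r]).
  by move=> w _; exact: norm_continuous.
exact: closed_le.
Qed.

Lemma lipschitz_within_continuous m (A : set 'rV[R]_m) (g : 'rV[R]_m -> R) (L : R) :
  (forall w w', A w -> A w' -> `|g w - g w'| <= L * `|w - w'|) ->
  {within A, continuous g}.
Proof.
move=> gL; apply/subspace_continuousP => w Aw; apply/cvgrPdist_lt => e e0.
have L0 : 0 < `|L| + 1 by rewrite ltr_wpDl.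
rewrite near_withinE; apply/nbhs_ballP; exists (e / (`|L| + 1)) => /=.
  by rewrite divr_gt0.
move=> y; rewrite -ball_normE /= => wy Ay; apply: le_lt_trans (gL _ _ Aw Ay) _.
apply: (@le_lt_trans _ _ ((`|L| + 1) * `|w - y|)).
  by rewrite ler_wpM2r// (le_trans (ler_norm _))// lerDl.
by rewrite mulrC -ltr_pdivlMr.
Qed.

(** Minimize g(w) = |H w| + |w| / 2 over the compact ball. Moving from the minimizer w to w - H w
    lowers g by at least |H w| / 4, so H w = 0. Comparing g(w) with g(0) bounds |w| and keeps w - H
    w in the ball. *)
Lemma approx_id_zero m (H : 'rV[R]_m -> 'rV[R]_m) (r : R) :
  (forall w w', `|w| <= r -> `|w'| <= r ->
     `|H w - H w' - (w - w')| <= 4^-1 * `|w - w'|) ->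
  3 * `|H 0| <= r -> exists2 w, H w = 0 & `|w| <= 2 * `|H 0|.
Proof.
move=> HL Hr; pose A := [set w : 'rV[R]_m | `|w| <= r].
pose g (w : 'rV[R]_m) : R := `|H w| + 2^-1 * `|w|.
have H00 : 0 <= `|H 0| by [].
have A0 : A 0 by rewrite /A /= normr0; lra.
have gL w w' : A w -> A w' -> `|g w - g w'| <= 2 * `|w - w'|.
  move=> Aw Aw'; have h1 := HL _ _ Aw Aw'.
  have h2 : `|H w - H w'| <= `|H w - H w' - (w - w')| + `|w - w'|.
    by rewrite -{1}[H w - H w'](subrK (w - w')) ler_normD.
  have h3 := lerB_dist (H w) (H w'); have h4 := lerB_dist (H w') (H w).
  have h5 := lerB_dist w w'; have h6 := lerB_dist w' w.
  rewrite (distrC (H w')) in h4; rewrite (distrC w') in h6.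
  rewrite /g ler_norml; apply/andP; split; lra.
have [||w] := @EVT_min_rV _ _ g A _ (@closed_norm_ball_compact m r).
- by exists 0.
- exact: lipschitz_within_continuous gL.
rewrite inE /A /= => Aw wmin.
have g0 : g w <= `|H 0|.
  have := wmin 0; rewrite inE => /(_ A0); rewrite {2}/g normr0; lra.
have Hw0 : 0 <= `|H w| by []. have w0 : 0 <= `|w| by [].
have w2 : `|w| <= 2 * `|H 0| by move: g0; rewrite /g; lra.
exists w => //; apply/eqP; rewrite -normr_le0.
have n1 : `|w - H w| <= `|w| + `|H w| by exact: ler_normB.
have Aw' : A (w - H w) by move: g0; rewrite /A /g /=; lra.
have := wmin (w - H w); rewrite inE => /(_ Aw').
have := HL _ _ Aw' Aw; rewrite [w - H w - w]addrAC subrr add0r opprK subrK normrN.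
rewrite /g; lra.
Qed.

End ApproximateIdentity.

Lemma le0_small (R : realType) (a C : R) : 0 <= C -> (forall e, 0 < e <= 1 -> a <= C * e) -> a <= 0.
Proof.
move=> C0 h; rewrite leNgt; apply/negP => a0.
have Ca : 0 < C + a + 1 by rewrite ltr_wpDl// addr_ge0// ltW.
have := h (a / (C + a + 1)); rewrite divr_gt0// ler_pdivrMr// mul1r.
have le1 : a <= C + a + 1 by lra.
move=> /(_ le1); rewrite mulrA ler_pdivlMr// => h1.
have : 0 < a * (a + 1) by rewrite mulr_gt0// addr_gt0.
move: h1; rewrite [C * a]mulrC !mulrDr; lra.
Qed.

(* [J] plays the role of the Jacobian of [F]; only its Lipschitz continuity and
   the second-order Taylor estimate are used. *)
Definition regular_chart (R : realType) n m (M : set 'rV[R]_n) (x : 'rV[R]_n)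
    (F : 'rV[R]_n -> 'rV[R]_m) (J : 'rV[R]_n -> 'M[R]_(n, m)) (d K : R) : Prop :=
  [/\ 0 < d /\ 0 < K, M x /\ row_full (J x),
      forall y, `|y - x| < d -> M y <-> F y = 0,
      forall a b, `|a - x| < d -> `|b - x| < d -> `|J a - J b| <= K * `|a - b| &
      forall a b, `|a - x| < d -> `|b - x| < d ->
        `|F a - F b - (a - b) *m J b| <= K * `|a - b| ^+ 2].

Section RegularChart.
Variable R : realType.
Variables (n m : nat) (M : set 'rV[R]_n) (x : 'rV[R]_n).
Variables (F : 'rV[R]_n -> 'rV[R]_m) (J : 'rV[R]_n -> 'M[R]_(n, m)).
Variables (d K : R).
Hypothesis chart : regular_chart M x F J d K.

Let d0 : 0 < d. Proof. by have [[]] := chart. Qed.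
Let K0 : 0 < K. Proof. by have [[]] := chart. Qed.
Let Mx : M x. Proof. by have [_ []] := chart. Qed.
Let fA : row_full (J x). Proof. by have [_ []] := chart. Qed.
Let MF y : `|y - x| < d -> M y <-> F y = 0.
Proof. by have [_ _ + _ _] := chart; apply. Qed.
Let JL a b : `|a - x| < d -> `|b - x| < d -> `|J a - J b| <= K * `|a - b|.
Proof. by have [_ _ _ + _] := chart; apply. Qed.
Let FQ a b : `|a - x| < d -> `|b - x| < d ->
  `|F a - F b - (a - b) *m J b| <= K * `|a - b| ^+ 2.
Proof. by have [_ _ _ _] := chart; apply. Qed.

Lemma center_in_ball : `|x - x| < d. Proof. by rewrite subrr normr0. Qed.

(** The Taylor remainder at [b] contributes the 2, as |a - b| <= 2 e; replacing [J b] by the fixed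
    [J x] contributes the n. *)
Lemma strict_jacobian (e : R) a b : e <= d -> `|a - x| < e -> `|b - x| < e ->
  `|F a - F b - (a - b) *m J x| <= K * (2 + n%:R) * e * `|a - b|.
Proof.
move=> ed ax bx; have [ax' bx'] := (lt_le_trans ax ed, lt_le_trans bx ed).
have h1 := FQ ax' bx'; have h2 := JL bx' center_in_ball.
have h3 := mx_norm_mul (a - b) (J b - J x).
have ab : `|a - b| <= 2 * e.
  have -> : a - b = (a - x) - (b - x) by rewrite opprB addrA subrK.
  by apply: le_trans (ler_normB _ _) _; lra.
have -> : F a - F b - (a - b) *m J x =
    (F a - F b - (a - b) *m J b) + (a - b) *m (J b - J x).
  by rewrite mulmxBr addrA subrK.
apply: le_trans (ler_normD _ _) (le_trans (lerD h1 h3) _).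
have ab0 : 0 <= `|a - b| by [].
have e1 : K * `|a - b| ^+ 2 <= K * (2 * e) * `|a - b|.
  by rewrite expr2 -[leRHS]mulrA ler_wpM2l ?(ltW K0)// ler_wpM2r.
have e2 : n%:R * `|a - b| * `|J b - J x| <= n%:R * `|a - b| * (K * e).
  rewrite ler_wpM2l ?mulr_ge0//; apply: le_trans h2 _.
  by rewrite ler_wpM2l ?ltW.
apply: le_trans (lerD e1 e2) _.
by rewrite le_eqVlt; apply/orP; left; apply/eqP; ring.
Qed.

Lemma F_lipschitz : exists2 L : R, 0 < L &
  forall a b, `|a - x| < d -> `|b - x| < d -> `|F a - F b| <= L * `|a - b|.
Proof.
have [KA KA0 hA] := mulmx_bounded (J x).
exists (K * (2 + n%:R) * d + KA) => [|a b ax bx].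
  by rewrite ltr_wpDl// !mulr_ge0// ?addr_ge0// ltW.
rewrite -[F a - F b](subrK ((a - b) *m J x)) mulrDl.
by apply: le_trans (ler_normD _ _) (lerD (strict_jacobian (lexx d) ax bx) (hA _ _)).
Qed.

(* The correction [w *m lpinv (J x)] is orthogonal to the kernel of [J x], so
   the point found in [M] has the same tangential component as [z]. *)
Lemma solve_equation : exists2 r : R, 0 < r & exists2 C : R, 0 < C &
  forall z, `|z - x| < r -> exists w : 'rV[R]_m,
    [/\ M (z + w *m lpinv (J x)), `|w *m lpinv (J x)| <= C * `|F z| &
        `|w *m lpinv (J x)| <= C * `|z - x|].
Proof.
set B := lpinv (J x).
have [KB KB0 hB] := mulmx_bounded B.
have [L L0 FL] := F_lipschitz.
pose c := K * (2 + n%:R) * KB.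
have c0 : 0 < c by rewrite !mulr_gt0// ltr_wpDr.
(* As [B *m J x] is the identity, w |-> F (z + w B) is close to a translation: [e] makes the
   deviation at most 1/4, [s] keeps w B within e / 2, and [r] ensures 3 |F z| <= s, as
   [approx_id_zero] requires. *)
pose e := Num.min d (4^-1 / c).
have e0 : 0 < e by rewrite lt_min d0 divr_gt0.
have ed : e <= d by rewrite ge_min lexx.
have ec : K * (2 + n%:R) * e * KB <= 4^-1.
  by rewrite mulrAC -/c mulrC -ler_pdivlMr// ge_min lexx orbT.
pose s := e / 2 / KB.
have s0 : 0 < s by rewrite !divr_gt0.
have sK : KB * s = e / 2 by rewrite /s mulrC divfK// gt_eqF.
pose r := Num.min (e / 2) (s / (3 * L)).
have r0 : 0 < r by rewrite lt_min !divr_gt0// mulr_gt0.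
have Fx : F x = 0 by apply/MF => //; exact: center_in_ball.
exists r => //; exists (2 * KB * (1 + L)); first by rewrite !mulr_gt0// ltr_pwDl// ltW.
move=> z zr.
have [zr1 zr2] : `|z - x| < e / 2 /\ `|z - x| < s / (3 * L).
  by move: zr; rewrite lt_min => /andP.
pose H (w : 'rV[R]_m) := F (z + w *m B).
have zB (w : 'rV[R]_m) : `|w| <= s -> `|z + w *m B - x| < e.
  move=> ws; rewrite addrAC; apply: le_lt_trans (ler_normD _ _) _.
  have h : `|w *m B| <= KB * s by apply: le_trans (hB _ _) _; rewrite ler_wpM2l// ltW.
  lra.
have zd : `|z - x| < d by lra.
have Fz : `|F z| <= L * `|z - x|.
  by have := FL _ _ zd center_in_ball; rewrite Fx subr0.
have H0E : H 0 = F z by rewrite /H mul0mx addr0.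
have [w w' ws ws'||w Hw] := @approx_id_zero R m H s.
- have := strict_jacobian ed (zB _ ws) (zB _ ws').
  rewrite opprD [z + _ + _]addrACA subrr add0r -mulmxBl -mulmxA mul_lpinv// mulmx1.
  move=> h; apply: le_trans h _.
  apply: (@le_trans _ _ (K * (2 + n%:R) * e * (KB * `|w - w'|))).
    by rewrite ler_wpM2l ?hB// !mulr_ge0// ?addr_ge0// ltW.
  by rewrite mulrA ler_wpM2r.
- rewrite H0E -ler_pdivlMl//; apply: le_trans Fz _.
  by rewrite -ler_pdivlMl//; apply: le_trans (ltW zr2) _; rewrite invfM mulrC -mulrA mulrCA.
rewrite H0E => wF.
have wB : `|w *m B| <= 2 * KB * `|F z|.
  by have := ler_wpM2l (ltW KB0) wF; have := hB _ w; lra.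
have ws : `|w| <= s.
  apply: le_trans wF (le_trans (ler_wpM2l _ Fz) _) => //.
  move: zr2; rewrite ltr_pdivlMr ?mulr_gt0// => h.
  have : 0 <= L * `|z - x| by rewrite mulr_ge0// ltW.
  by move: h; rewrite mulrCA [`|z - x| * L]mulrC; lra.
exists w; split.
- by apply/MF => //; exact: lt_le_trans (zB _ ws) ed.
- apply: le_trans wB _; rewrite ler_wpM2r// mulrDr mulr1 lerDl.
  by rewrite !mulr_ge0// ltW.
- have h2 : 0 <= 2 * KB by rewrite mulr_ge0// ltW.
  have h3 := ler_wpM2l h2 Fz.
  have h4 : 0 <= 2 * KB * `|z - x| by rewrite mulr_ge0.
  by lra.
Qed.

(** Since [v] is in the kernel of [J p], F (p + t v) is of order t^2, and [solve_equation] moves p +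
    t v into [M] by a correction of that order. Arbitrarily small t are enough for first-order
    arguments. *)
Lemma tangent_curve : exists2 r : R, 0 < r & forall p v : 'rV[R]_n,
  `|p - x| < r -> M p -> v *m J p = 0 ->
  forall e : R, 0 < e -> exists t : R, [/\ 0 < t, t <= e &
    exists2 y, M y & `|y - p - t *: v| <= e * t].
Proof.
have [r r0 [C C0 solve]] := solve_equation.
pose s := Num.min r d / 2; have s0 : 0 < s by rewrite divr_gt0// lt_min r0.
have [sr sd] : s * 2 <= r /\ s * 2 <= d by rewrite divfK// !ge_min !lexx orbT.
clearbody s; exists s => // p v px Mp vJ e e0.
pose k := C * K * `|v| ^+ 2 + 1.
have k0 : 0 < k by rewrite ltr_wpDl// !mulr_ge0// ltW.
have v1 : 0 < `|v| + 1 by rewrite ltr_wpDl.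
(* The second bound keeps p + t v in the ball where the equation is solvable; the third makes the
   quadratic correction at most e t. *)
pose t := Num.min e (Num.min (s / (`|v| + 1)) (e / k)).
have t0 : 0 < t by rewrite !lt_min e0 !divr_gt0//.
have te : t <= e by rewrite ge_min lexx.
have ts : t * (`|v| + 1) <= s by rewrite -ler_pdivlMr// !ge_min lexx !orbT.
have tk : t * k <= e by rewrite -ler_pdivlMr// !ge_min lexx !orbT.
have tv : `|t *: v| = t * `|v| by rewrite normrZ gtr0_norm.
have zx : `|p + t *: v - x| < s * 2.
  rewrite addrAC; apply: le_lt_trans (ler_normD _ _) _; rewrite tv; lra.
have pd : `|p - x| < d by lra.
have Fp : F p = 0 by apply/MF.
have Fz : `|F (p + t *: v)| <= K * (t * `|v|) ^+ 2.
  have := FQ (lt_le_trans zx sd) pd.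
  by rewrite Fp subr0 [p + _ - p]addrAC subrr add0r -scalemxAl vJ scaler0 subr0 tv.
have [w [Mw wB _]] := solve _ (lt_le_trans zx sr).
exists t; split=> //; exists (p + t *: v + w *m lpinv (J x)) => //.
rewrite [_ + _ - p]addrAC [p + _ - p]addrAC subrr add0r addrAC subrr add0r.
apply: le_trans wB (le_trans (ler_wpM2l (ltW C0) Fz) _).
have -> : C * (K * (t * `|v|) ^+ 2) = (C * K * `|v| ^+ 2 * t) * t by ring.
by rewrite ler_wpM2r ?(ltW t0)//; move: tk; rewrite /k; lra.
Qed.

(** Comparing [p] with a competitor y close to p + t v and dividing the expanded inequality by t
    gives <u - p, v> <= O(e). The vector -v gives the opposite sign. *)
Lemma projection_normal : exists2 r : R, 0 < r & forall u p v : 'rV[R]_n,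
  `|p - x| < r -> proj_set M u p -> v *m J p = 0 -> dotv (u - p) v = 0.
Proof.
have [r r0 curve] := tangent_curve; exists r => // u p.
suff le0 (v : 'rV[R]_n) : `|p - x| < r -> proj_set M u p -> v *m J p = 0 ->
    dotv (u - p) v <= 0.
  move=> v pr Mp vJ; apply/eqP; rewrite eq_le le0//= -oppr_le0 -dotvNr le0//.
  by rewrite mulNmx vJ oppr0.
move=> pr [Mp pmin] vJ.
apply: (@le0_small _ _ (n%:R * `|u - p| + n%:R * (`|v| + 1) ^+ 2)).
  by rewrite addr_ge0// mulr_ge0// sqr_ge0.
move=> e /andP[e0 e1]; have [t [t0 te [y My yt]]] := curve p v pr Mp vJ e e0.
have := pmin y My; rewrite enorm_le.
set a := u - p; set b := y - p - t *: v in yt *.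
have -> : u - y = a - (t *: v + b).
  by rewrite /a /b [t *: v + _]addrC subrK opprB addrA subrK.
clearbody a b; rewrite dotv_sub dotvDr dotvZr => h1.
have h2 := le_trans (ler_norm _) (dotv_norm (t *: v + b) (t *: v + b)).
have h3 := dotv_norm a b.
have tvb : `|t *: v + b| <= t * (`|v| + 1).
  apply: le_trans (ler_normD _ _) _; rewrite normrZ gtr0_norm// mulrDr mulr1 lerD2l.
  by apply: le_trans yt _; rewrite ler_piMl// ltW.
have h4 : dotv (t *: v + b) (t *: v + b) <= n%:R * (t * (`|v| + 1)) ^+ 2.
  by apply: le_trans h2 _; rewrite -mulrA ler_wpM2l// expr2 ler_pM.
have h5 : - dotv a b <= n%:R * `|a| * (e * t).
  apply: le_trans (ler_norm _) _; rewrite normrN; apply: le_trans h3 _.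
  by rewrite ler_wpM2l// mulr_ge0.
have h6 : 2 * (t * dotv a v) <= t * (2 * (n%:R * `|a| * e) + n%:R * (`|v| + 1) ^+ 2 * t).
  rewrite [leRHS](_ : _ = 2 * (n%:R * `|a| * (e * t)) + n%:R * (t * (`|v| + 1)) ^+ 2); lra.
have h7 : 2 * dotv a v <= 2 * (n%:R * `|a| * e) + n%:R * (`|v| + 1) ^+ 2 * t.
  by rewrite -(ler_pM2l t0) mulrCA.
have h8 : n%:R * (`|v| + 1) ^+ 2 * t <= n%:R * (`|v| + 1) ^+ 2 * e.
  by rewrite ler_wpM2l// mulr_ge0// sqr_ge0.
have h9 : 0 <= n%:R * (`|v| + 1) ^+ 2 * e by rewrite !mulr_ge0// ?sqr_ge0// ltW.
lra.
Qed.

(** Lagrange multipliers: what is orthogonal to the kernel of [J p] lies in the row space of its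
    transpose. Membership is tested on the columns of [cokermx], whose transposes belong to that
    kernel. *)
Lemma projection_multiplier : exists2 r : R, 0 < r & forall u p : 'rV[R]_n,
  `|p - x| < r -> proj_set M u p -> exists l : 'rV[R]_m, u - p = l *m (J p)^T.
Proof.
have [r r0 normal] := projection_normal; exists r => // u p pr Mp.
apply/submxP; rewrite submxE; apply/eqP/rowP => j; rewrite [RHS]mxE.
have := normal u p (col j (cokermx (J p)^T))^T pr Mp.
rewrite /dotv trmxK colE mulmxA => <-; last first.
  apply: trmx_inj; rewrite trmx_mul trmxK mulmxA mulmx_coker mul0mx trmx0 //.
by rewrite -colE [RHS]mxE.
Qed.

(** The error is (p - q) A B minus (u - v - (p - q)) P, with A B = 1 - P. The first term is small
    because F p = F q = 0 makes p - q nearly tangent. The second is small because multipliers write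
    u - v - (p - q) as (l - k) (J p)^T + k (J p - J q)^T, with k = O(s). The |p - q| on the right is
    absorbed in [strictly_diff_proj]. *)
Lemma projection_estimate : exists2 r : R, 0 < r & exists2 C : R, 0 < C &
  forall (s : R) u v p q, s <= r -> `|u - x| < s -> `|v - x| < s ->
    proj_set M u p -> proj_set M v q ->
    `|p - q - (u - v) *m kproj (J x)| <= C * s * (`|u - v| + `|p - q|).
Proof.
have [r1 r10 mult] := projection_multiplier.
set A := J x; set B := lpinv A; set P := kproj A.
have [KB KB0 hB] := mulmx_bounded B.
have [KBT KBT0 hBT] := mulmx_bounded B^T.
have [KP KP0 hP] := mulmx_bounded P.
have n1 : 0 < n%:R + 1 :> R by rewrite ltr_wpDl.
have m0 : 0 <= m%:R :> R by [].
have c0 : 0 < KBT * m%:R * K + 1 by rewrite ltr_wpDl// !mulr_ge0// ltW.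
(* The last bound limits the perturbation of the left inverse to 1/2, whence the factor 2 in
   [coef]. *)
pose e := Num.min r1 (Num.min d (2^-1 / (KBT * m%:R * K + 1))).
have e0 : 0 < e by rewrite !lt_min r10 d0 divr_gt0.
have [er ed ec] : [/\ e <= r1, e <= d & KBT * m%:R * K * e <= 2^-1].
  split; rewrite ?ge_min ?lexx ?orbT//.
  have : e * (KBT * m%:R * K + 1) <= 2^-1.
    by rewrite -ler_pdivlMr// !ge_min lexx !orbT.
  by rewrite mulrDr mulr1 [e * _]mulrC; lra.
clearbody e.
(* The point [x] of [M] competes with [p]; the factor n is the price of passing from the Euclidean
   norm to the sup norm. *)
have close (s : R) (u p : 'rV[R]_n) : `|u - x| < s -> proj_set M u p ->
    `|u - p| <= n%:R * s /\ `|p - x| <= (n%:R + 1) * s.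
  move=> us [_ pmin].
  have h1 : `|u - p| <= n%:R * s.
    apply: le_trans (mx_norm_enorm _) (le_trans (pmin _ Mx) _).
    by apply: le_trans (enorm_mx_norm _) _; rewrite ler_wpM2l// ltW.
  split=> //; have -> : p - x = (u - x) - (u - p).
    by apply/rowP => i; rewrite !mxE; ring.
  by apply: le_trans (ler_normB _ _) _; lra.
(* [l] is recovered from [l *m (J p)^T] because [B] is nearly a left inverse of [J p]. *)
have coef (p : 'rV[R]_n) (l : 'rV[R]_m) : `|p - x| < e ->
    `|l| <= 2 * KBT * `|l *m (J p)^T|.
  move=> pe.
  have lE : l = l *m (J p)^T *m B^T - l *m (J p - A)^T *m B^T.
    rewrite -mulmxBl -mulmxBr -linearB /= opprB addrC subrK.
    by rewrite -mulmxA -trmx_mul mul_lpinv// trmx1 mulmx1.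
  have h1 := hBT _ (l *m (J p)^T); have h2 := hBT _ (l *m (J p - A)^T).
  have h3 := mx_norm_mul l (J p - A)^T; rewrite mx_norm_tr in h3.
  have h4 : `|J p - A| <= K * e.
    apply: le_trans (JL (lt_le_trans pe ed) center_in_ball) _.
    by rewrite ler_wpM2l ?ltW.
  have h5 : KBT * `|l *m (J p - A)^T| <= 2^-1 * `|l|.
    apply: le_trans (_ : KBT * (m%:R * `|l| * (K * e)) <= _).
      rewrite ler_wpM2l ?(ltW KBT0)//; apply: le_trans h3 _.
      by rewrite ler_wpM2l// mulr_ge0.
    have -> : KBT * (m%:R * `|l| * (K * e)) = KBT * m%:R * K * e * `|l| by ring.
    by rewrite ler_wpM2r.
  have h6 : `|l| <= `|l *m (J p)^T *m B^T| + `|l *m (J p - A)^T *m B^T|.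
    by rewrite {1}lE ler_normB.
  lra.
(* Nearest points of the ball of radius s lie within (n + 1) s of [x]; the additional 1 makes this
   bound strict. *)
pose r := e / (n%:R + 1 + 1).
have n2 : 0 < n%:R + 1 + 1 :> R by rewrite addr_gt0.
have r0 : 0 < r by rewrite divr_gt0.
have rE : r * (n%:R + 1 + 1) = e by rewrite divfK// gt_eqF.
clearbody r.
exists r => //.
(* [C1] is for the tangential defect of p - q, [C2] for the term with l - k, and [C3] for the term
   with J p - J q. *)
pose C1 := KB * (K * (2 + n%:R) * (n%:R + 1 + 1)).
pose C2 := m%:R * (2 * KBT) * (1 + m%:R * (2 * KBT * n%:R * r) * K) * K * (n%:R + 1).
pose C3 := m%:R * (2 * KBT * n%:R) * K.
have C10 : 0 <= C1 by rewrite /C1 !mulr_ge0// ?addr_ge0// ltW.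
have C20 : 0 <= C2.
  by rewrite /C2 !mulr_ge0// ?addr_ge0// ?mulr_ge0// ltW// mulr_gt0// ltr_wpDl.
have C30 : 0 <= C3 by rewrite /C3 !mulr_ge0// ltW.
exists (C1 + KP * (C2 + C3) + 1).
  by rewrite ltr_wpDl// addr_ge0// mulr_ge0 ?(ltW KP0)// addr_ge0.
move=> s u v p q sr us vs Mp Mq.
have s0 : 0 < s by exact: le_lt_trans us.
have [up px] := close _ _ _ us Mp; have [vq qx] := close _ _ _ vs Mq.
have se : s * (n%:R + 1 + 1) <= e by rewrite -rE ler_wpM2r// ltW.
have ps : `|p - x| < s * (n%:R + 1 + 1) by lra.
have qs : `|q - x| < s * (n%:R + 1 + 1) by lra.
have pe := lt_le_trans ps se; have qe := lt_le_trans qs se.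
have [l lE] := mult u p (lt_le_trans pe er) Mp.
have [k kE] := mult v q (lt_le_trans qe er) Mq.
have Fp : F p = 0 by apply/MF; [exact: lt_le_trans pe ed|exact: Mp.1].
have Fq : F q = 0 by apply/MF; [exact: lt_le_trans qe ed|exact: Mq.1].
have tang : `|(p - q) *m A *m B| <= C1 * s * `|p - q|.
  apply: le_trans (hB _ _) _.
  have := strict_jacobian (le_trans se ed) ps qs.
  rewrite Fp Fq subrr sub0r normrN -/A => h.
  apply: le_trans (ler_wpM2l (ltW KB0) h) _.
  by rewrite le_eqVlt; apply/orP; left; apply/eqP; rewrite /C1; ring.
have kB : `|k| <= 2 * KBT * n%:R * s.
  apply: le_trans (coef q k qe) _; rewrite -kE -[leRHS]mulrA ler_wpM2l//.
  by rewrite mulr_ge0// ltW.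
have JB : `|J p - J q| <= K * `|p - q|.
  by apply: JL; [exact: lt_le_trans pe ed|exact: lt_le_trans qe ed].
have kJ : `|k *m (J p - J q)^T| <= C3 * s * `|p - q|.
  apply: le_trans (mx_norm_mul _ _) _; rewrite mx_norm_tr.
  apply: (@le_trans _ _ (m%:R * (2 * KBT * n%:R * s) * (K * `|p - q|))).
    by rewrite ler_pM// ?mulr_ge0// ler_wpM2l.
  by rewrite le_eqVlt; apply/orP; left; apply/eqP; rewrite /C3; ring.
have trB (X Y : 'M[R]_(n, m)) : (X - Y)^T = X^T - Y^T by exact: linearB.
have lkE : (l - k) *m (J p)^T = (u - v) - (p - q) - k *m (J p - J q)^T.
  rewrite trB mulmxBr mulmxBl -lE -kE.
  by apply/rowP => i; rewrite !mxE; ring.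
set D := `|u - v| + `|p - q|.
have D0 : 0 <= D by rewrite addr_ge0.
have pqD : `|p - q| <= D by rewrite lerDr.
have lkB : `|l - k| <= 2 * KBT * ((1 + m%:R * (2 * KBT * n%:R * r) * K) * D).
  apply: le_trans (coef p _ pe) _; rewrite ler_wpM2l//; first by rewrite mulr_ge0// ltW.
  rewrite lkE; apply: le_trans (ler_normB _ _) _; rewrite mulrDl mul1r lerD ?ler_normB//.
  apply: le_trans kJ _; rewrite [leRHS](_ : _ = C3 * r * D); last by rewrite /C3; ring.
  by apply: ler_pM => //; [exact: mulr_ge0 C30 (ltW s0)|exact: ler_wpM2l].
have normal : `|(u - v - (p - q)) *m P| <= KP * ((C2 + C3) * s * D).
  have -> : (u - v - (p - q)) *m P =
      ((l - k) *m (J p - A)^T + k *m (J p - J q)^T) *m P.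
    (* Since P annihilates A^T, [J p] may be replaced by J p - A, which is O(s): this supplies the
       factor s. *)
    have AP : A^T *m P = 0 by exact: trmx_mul_kproj.
    have E : (l - k) *m (J p - A)^T *m P = (l - k) *m (J p)^T *m P.
      by rewrite -!mulmxA (trB _ A) [((J p)^T - A^T) *m P]mulmxBl AP subr0.
    by rewrite mulmxDl E -mulmxDl lkE subrK.
  apply: le_trans (hP _ _) _; rewrite ler_wpM2l ?(ltW KP0)//.
  apply: le_trans (ler_normD _ _) _; rewrite !mulrDl lerD//; last first.
    by apply: le_trans kJ _; apply: ler_wpM2l => //; exact: mulr_ge0 C30 (ltW s0).
  apply: le_trans (mx_norm_mul _ _) _; rewrite mx_norm_tr.
  apply: (@le_trans _ _ (m%:R *
      (2 * KBT * ((1 + m%:R * (2 * KBT * n%:R * r) * K) * D)) * (K * ((n%:R + 1) * s)))).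
    rewrite ler_pM// ?mulr_ge0//; first by rewrite ler_wpM2l.
    apply: le_trans (JL (lt_le_trans pe ed) center_in_ball) _.
    by rewrite ler_wpM2l ?(ltW K0).
  by rewrite le_eqVlt; apply/orP; left; apply/eqP; rewrite /C2; ring.
have -> : p - q - (u - v) *m P = (p - q) *m A *m B - (u - v - (p - q)) *m P.
  have E1 : (p - q) *m P = p - q - (p - q) *m A *m B.
    by rewrite /P /kproj (mulmxBr (p - q)) mulmx1 mulmxA.
  rewrite (mulmxBl (u - v) (p - q)) E1.
  move: ((p - q) *m A *m B) ((u - v) *m P) => X Y.
  by apply/rowP => i; rewrite !mxE; ring.
apply: le_trans (ler_normB _ _) (le_trans (lerD tang normal) _).
have h1 : C1 * s * `|p - q| <= C1 * s * D.
  by apply: ler_wpM2l => //; exact: mulr_ge0 C10 (ltW s0).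
have h2 : 0 <= s * D by rewrite mulr_ge0// ltW.
apply: le_trans (lerD h1 (lexx _)) _; rewrite -/D; lra.
Qed.

(** Points of [M] near x + t v, found with the first chart, are zeros of F', so the Taylor bound for
    F' gives t |v J'(x)| = o(t). Hence the kernel does not depend on the chart. *)
Lemma kernel_sub m' (F' : 'rV[R]_n -> 'rV[R]_m') (J' : 'rV[R]_n -> 'M[R]_(n, m'))
    (d' K' : R) (v : 'rV[R]_n) :
  regular_chart M x F' J' d' K' -> v *m J x = 0 -> v *m J' x = 0.
Proof.
move=> [[d'0 K'0] _ MF' _ FQ'] vJ; have [r r0 curve] := tangent_curve.
have [KJ KJ0 hJ] := mulmx_bounded (J' x).
have v1 : 0 < `|v| + 1 by rewrite ltr_wpDl.
(* Running the curve with tolerance e c keeps its points within d' of [x], where the second chart is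
   valid. *)
pose c := Num.min 1 (d' / 2 / (`|v| + 1)).
have c0 : 0 < c by rewrite lt_min ltr01 !divr_gt0.
have c1 : c <= 1 by rewrite ge_min lexx.
have cd : c * (`|v| + 1) <= d' / 2 by rewrite -ler_pdivlMr// ge_min lexx orbT.
clearbody c.
have xx : `|x - x| < d' by rewrite subrr normr0.
apply/eqP; rewrite -normr_le0; apply: (@le0_small _ _ (K' * (`|v| + 1) ^+ 2 + KJ)).
  by rewrite addr_ge0// ?(ltW KJ0)// mulr_ge0 ?sqr_ge0// ltW.
move=> e /andP[e0 e1].
have xr : `|x - x| < r by rewrite subrr normr0.
have [t [t0 te [y My yt]]] := curve x v xr Mx vJ (e * c) (mulr_gt0 e0 c0).
have ece : e * c <= e by rewrite ler_piMr// ltW.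
have ecc : e * c <= c by rewrite ler_piMl// ltW.
have yx : `|y - x| <= t * (`|v| + 1).
  rewrite -[y - x](subrK (t *: v)); apply: le_trans (ler_normD _ _) _.
  rewrite normrZ gtr0_norm// mulrDr mulr1 addrC lerD2l.
  apply: le_trans yt _; rewrite ler_piMl ?(ltW t0)//; lra.
have yd : `|y - x| < d'.
  have : t * (`|v| + 1) <= c * (`|v| + 1) by rewrite ler_wpM2r ?(ltW v1)//; lra.
  lra.
have [Fy Fx] : F' y = 0 /\ F' x = 0 by split; apply/MF'.
have := FQ' _ _ yd xx; rewrite Fx Fy subrr sub0r normrN => h1.
have h2 : K' * `|y - x| ^+ 2 <= K' * (t * (`|v| + 1)) ^+ 2.
  by rewrite ler_wpM2l ?(ltW K'0)// !expr2 ler_pM.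
have h3 := hJ _ (y - x - t *: v).
have h4 : KJ * `|y - x - t *: v| <= KJ * (e * t).
  rewrite ler_wpM2l ?(ltW KJ0)//; apply: le_trans yt _.
  by rewrite ler_wpM2r ?(ltW t0).
have h5 : t * `|v *m J' x| <= `|(y - x) *m J' x| + `|(y - x - t *: v) *m J' x|.
  have -> : t * `|v *m J' x| = `|(y - x) *m J' x - (y - x - t *: v) *m J' x|.
    by rewrite -mulmxBl opprB addrC subrK -scalemxAl normrZ gtr0_norm.
  exact: ler_normB.
have h6 : K' * (`|v| + 1) ^+ 2 * t <= K' * (`|v| + 1) ^+ 2 * e.
  by rewrite ler_wpM2l ?mulr_ge0 ?sqr_ge0 ?(ltW K'0)//; lra.
rewrite -(ler_pM2l t0).
apply: (@le_trans _ _ (t * (K' * (`|v| + 1) ^+ 2 * t + KJ * e))); first lra.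
by rewrite ler_wpM2l ?(ltW t0)//; lra.
Qed.

End RegularChart.

(** * The linearized operator *)

Section StrictDifferentiability.
Variables (R : realType) (n : nat).
Implicit Types (Phi Psi : 'rV[R]_n -> set 'rV[R]_n) (x : 'rV[R]_n) (L : 'M[R]_n).

(** A two-point derivative, since images of two moving points are compared. It quantifies over all
    selections; the case u = v shows that [Phi] has at most one value at each point near [x]. *)
Definition strictly_diff_at Phi x L : Prop :=
  forall e : R, 0 < e -> exists2 r : R, 0 < r & forall u v p q,
    `|u - x| < r -> `|v - x| < r -> Phi u p -> Phi v q ->
    `|p - q - (u - v) *m L| <= e * `|u - v|.

Definition relaxed (a : R) Phi u : set 'rV[R]_n :=
  [set (1 - a) *: u + a *: p | p in Phi u].

Definition set_comp Psi Phi u : set 'rV[R]_n := \bigcup_(y in Phi u) Psi y.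

Lemma strictly_diff_proj m (M : set 'rV[R]_n) x (F : 'rV[R]_n -> 'rV[R]_m) J d K :
  regular_chart M x F J d K -> strictly_diff_at (proj_set M) x (kproj (J x)).
Proof.
move=> /projection_estimate[r r0 [C C0 est]] e e0.
have [KP KP0 hP] := mulmx_bounded (kproj (J x)).
(* With s C <= 1/2 and |p - q| <= |E| + KP |u - v|, half of |E| moves to the left, leaving |E| <= s
   c |u - v|. *)
pose c := 2 * C * (1 + KP).
have c0 : 0 < c by rewrite !mulr_gt0// addr_gt0.
pose s := Num.min r (Num.min (2^-1 / C) (e / c)).
have s0 : 0 < s by rewrite !lt_min r0 !divr_gt0.
have [sr sC se] : [/\ s <= r, s * C <= 2^-1 & s * c <= e].
  by split; rewrite -?ler_pdivlMr// !ge_min lexx ?orbT.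
clearbody s; exists s => // u v p q us vs Mp Mq.
have := est s u v p q sr us vs Mp Mq.
set E := p - q - _ => h1.
have h2 : `|p - q| <= `|E| + KP * `|u - v|.
  rewrite -[p - q](subrK ((u - v) *m kproj (J x))) -/E.
  by apply: le_trans (ler_normD _ _) _; rewrite lerD2l.
have h3 : C * s * `|p - q| <= C * s * (`|E| + KP * `|u - v|).
  by rewrite ler_wpM2l// mulr_ge0 ?ltW.
have h4 : s * C * `|E| <= 2^-1 * `|E| by rewrite ler_wpM2r.
have h5 : s * c * `|u - v| <= e * `|u - v| by rewrite ler_wpM2r.
by move: h5; rewrite /c; lra.
Qed.

Lemma strictly_diff_relaxed a Phi x L : strictly_diff_at Phi x L ->
  strictly_diff_at (relaxed a Phi) x ((1 - a)%:M + a *: L).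
Proof.
move=> dPhi e e0; have a1 : 0 < `|a| + 1 by rewrite ltr_wpDl.
have [r r0 h] := dPhi (e / (`|a| + 1)) (divr_gt0 e0 a1).
exists r => // u v _ _ ur vr [p Phip <-] [q Phiq <-].
have -> : (1 - a) *: u + a *: p - ((1 - a) *: v + a *: q) -
    (u - v) *m ((1 - a)%:M + a *: L) = a *: (p - q - (u - v) *m L).
  rewrite mulmxDr mul_mx_scalar -scalemxAr; move: ((u - v) *m L) => w.
  by apply/rowP => i; rewrite !mxE; ring.
rewrite normrZ; apply: le_trans (ler_wpM2l _ (h u v p q ur vr Phip Phiq)) _ => //.
rewrite mulrA ler_wpM2r// mulrCA ler_piMr ?(ltW e0)//.
by rewrite ler_pdivrMr// mul1r lerDl.
Qed.

(** The chain rule. As [x] is a value of [Phi] at [x], the Lipschitz bound keeps intermediate points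
    near [x]; the outer map adds an error e1 (1 + K1) and the inner one K2 e1. *)
Lemma strictly_diff_comp Psi Phi x L1 L2 : Phi x x ->
  strictly_diff_at Phi x L1 -> strictly_diff_at Psi x L2 ->
  strictly_diff_at (set_comp Psi Phi) x (L1 *m L2).
Proof.
move=> Phix d1 d2 e e0.
have [K1 K10 h1] := mulmx_bounded L1; have [K2 K20 h2] := mulmx_bounded L2.
have k0 : 0 < 1 + K1 + K2 by rewrite !addr_gt0.
pose e1 := Num.min 1 (e / (1 + K1 + K2)).
have e10 : 0 < e1 by rewrite lt_min ltr01 divr_gt0.
have e11 : e1 <= 1 by rewrite ge_min lexx.
have e1e : e1 * (1 + K1 + K2) <= e by rewrite -ler_pdivlMr// ge_min lexx orbT.
clearbody e1.
have [r1 r10 hr1] := d1 e1 e10; have [r2 r20 hr2] := d2 e1 e10.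
have K11 : 0 < 1 + K1 by rewrite addr_gt0.
have lip u v y z : `|u - x| < r1 -> `|v - x| < r1 -> Phi u y -> Phi v z ->
    `|y - z| <= (1 + K1) * `|u - v|.
  move=> ur vr uy vz; rewrite -[y - z](subrK ((u - v) *m L1)) mulrDl.
  apply: le_trans (ler_normD _ _) (lerD _ (h1 _ _)).
  by apply: le_trans (hr1 _ _ _ _ ur vr uy vz) _; rewrite ler_wpM2r.
exists (Num.min r1 (r2 / (1 + K1))); first by rewrite lt_min r10 divr_gt0.
move=> u v p q; rewrite !lt_min !ltr_pdivlMr//.
move=> /andP[ur1 ur2] /andP[vr1 vr2] [y uy yp] [z vz zq].
have xr1 : `|x - x| < r1 by rewrite subrr normr0.
have yr : `|y - x| < r2.
  by apply: le_lt_trans (lip _ _ _ _ ur1 xr1 uy Phix) _; rewrite mulrC.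
have zr : `|z - x| < r2.
  by apply: le_lt_trans (lip _ _ _ _ vr1 xr1 vz Phix) _; rewrite mulrC.
have -> : p - q - (u - v) *m (L1 *m L2) =
    (p - q - (y - z) *m L2) + (y - z - (u - v) *m L1) *m L2.
  by rewrite [(_ - _ *m L1) *m L2]mulmxBl addrA subrK mulmxA.
have h3 := hr2 _ _ _ _ yr zr yp zq; have h4 := hr1 _ _ _ _ ur1 vr1 uy vz.
have h5 := h2 _ (y - z - (u - v) *m L1); have h6 := lip _ _ _ _ ur1 vr1 uy vz.
apply: le_trans (ler_normD _ _) _.
have h7 := ler_wpM2l (ltW K20) h4; have h8 := ler_wpM2l (ltW e10) h6.
have h9 : e1 * (1 + K1 + K2) * `|u - v| <= e * `|u - v| by rewrite ler_wpM2r.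
lra.
Qed.

Lemma proj_set_id (M : set 'rV[R]_n) x : M x -> proj_set M x x.
Proof.
move=> Mx; split=> // c _; rewrite subrr enorm_le {1}/dotv mul0mx mxE.
exact: dotv_ge0.
Qed.

Lemma relaxed_id a Phi x : Phi x x -> relaxed a Phi x x.
Proof. by move=> Phix; exists x => //; rewrite -scalerDl subrK scale1r. Qed.

End StrictDifferentiability.

(** * Fixed vectors and spectrum of the linearized operator *)

Section LinearOperator.
Variables (R : realType) (n : nat).

(** With z = w - w P the image is w - a z, and <w, z> = |z|^2. So a relaxed projection does not
    increase norms for 0 <= a <= 2; for 0 < a < 2 it preserves them only on the kernel, while a = 2
    is an isometric reflection. *)
Lemma dotv_relaxed m (A : 'M[R]_(n, m)) a (w : 'rV[R]_n) : row_full A ->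
  let Ra := (1 - a)%:M + a *: kproj A in
  dotv (w *m Ra) (w *m Ra) = dotv w w -
    a * (2 - a) * dotv (w - w *m kproj A) (w - w *m kproj A).
Proof.
move=> fA /=; set P := kproj A.
have -> : w *m ((1 - a)%:M + a *: P) = w - a *: (w - w *m P).
  rewrite mulmxDr mul_mx_scalar -scalemxAr; move: (w *m P) => z.
  by apply/rowP => i; rewrite !mxE; ring.
have o : dotv (w *m P) (w - w *m P) = 0.
  by rewrite dotv_kproj// mulmxBl -mulmxA kproj_idem// subrr /dotv trmx0 mulmx0 mxE.
set z := w - w *m P in o *.
have wz : dotv w z = dotv z z by rewrite -[in LHS](subrK (w *m P) w) dotvDl o addr0.
by rewrite dotv_sub dotvZr !dotvZl dotvZr wz; ring.
Qed.

Lemma relaxed_fixed m (A : 'M[R]_(n, m)) a (w : 'rV[R]_n) : row_full A ->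
  a != 0 -> (w *m ((1 - a)%:M + a *: kproj A) == w) = (w *m A == 0).
Proof.
move=> fA a0; rewrite mulmxDr mul_mx_scalar -scalemxAr.
rewrite -subr_eq0 (_ : _ - w = a *: (w *m kproj A - w)); last first.
  by move: (w *m _) => z; apply/rowP => i; rewrite !mxE; ring.
rewrite scaler_eq0 (negPf a0) /= subr_eq0; apply/eqP/eqP => [<-|]; last exact: kproj_id.
by rewrite -mulmxA kproj_mul// mulmx0.
Qed.

Variables (mM mN mI : nat) (AM : 'M[R]_(n, mM)) (AN : 'M[R]_(n, mN)) (AI : 'M[R]_(n, mI)).
Hypotheses (fM : row_full AM) (fN : row_full AN) (fI : row_full AI).
Hypothesis kerI : forall v : 'rV[R]_n, v *m AI = 0 <-> v *m AM = 0 /\ v *m AN = 0.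
Variables (al a1 a2 : R).
Hypotheses (al0 : 0 < al) (a10 : 0 < a1 <= 2) (a20 : 0 < a2 <= 2).
Hypothesis a12 : a1 < 2 \/ a2 < 2.

Local Notation PM := (kproj AM).
Local Notation PN := (kproj AN).
Local Notation P := (kproj AI).
Local Notation L := (S_T_mx al a1 a2 PM PN).

(** Dividing by [al], [v] is fixed by R1 R2, so neither factor loses norm and both defects in
    [dotv_relaxed] vanish. The factor with parameter below 2 then fixes its argument, so the other
    factor fixes [v] too. *)
Lemma S_T_fixed (v : 'rV[R]_n) : v *m L = v -> v *m AI = 0.
Proof.
rewrite /S_T_mx; set R1 := _ + _ *: PN; set R2 := _ + _ *: PM.
rewrite mulmxDr mul_mx_scalar -scalemxAr [v *m (R1 *m R2)]mulmxA => vL.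
have {}vL : v *m R1 *m R2 = v.
  apply/eqP; rewrite -subr_eq0; have : al *: (v *m R1 *m R2 - v) == 0.
    rewrite -[X in X == _](_ : (1 - al) *: v + al *: (v *m R1 *m R2) - v = _).
      by rewrite vL subrr.
    by move: (v *m R1 *m R2) => z; apply/rowP => i; rewrite !mxE; ring.
  by rewrite scaler_eq0 (gt_eqF al0).
have := dotv_relaxed a2 (v *m R1) fM; have := dotv_relaxed a1 v fN.
rewrite /= -/R1 -/R2 vL => -> e.
have [a1p a12'] := andP a10; have [a2p a22'] := andP a20.
set D1 := dotv (v - _) _ in e; set D2 := dotv (v *m R1 - _) _ in e.
have g1 : 0 <= a1 * (2 - a1) * D1.
  by rewrite !mulr_ge0 ?(ltW a1p) ?subr_ge0 ?dotv_ge0.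
have g2 : 0 <= a2 * (2 - a2) * D2.
  by rewrite !mulr_ge0 ?(ltW a2p) ?subr_ge0 ?dotv_ge0.
have z1 : a1 * (2 - a1) * D1 = 0 by lra.
have z2 : a2 * (2 - a2) * D2 = 0 by lra.
have fix1 : v *m R1 = v -> v *m AM = 0 /\ v *m AN = 0.
  move=> v1; move: vL; rewrite v1 => /eqP; rewrite relaxed_fixed// ?gt_eqF// => /eqP vM.
  by split=> //; apply/eqP; rewrite -(@relaxed_fixed _ _ a1)// ?gt_eqF// -/R1 v1.
apply/kerI/fix1; case: a12 => h.
- have /dotv_eq0/eqP : D1 = 0.
    apply/eqP; move/eqP: z1; rewrite !mulf_eq0 (gt_eqF a1p) /= => /orP[|//].
    by rewrite subr_eq0 gt_eqF.
  rewrite subr_eq0 => /eqP vP; apply/eqP; rewrite relaxed_fixed ?gt_eqF//.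
  by rewrite vP -mulmxA kproj_mul// mulmx0.
- have /dotv_eq0/eqP : D2 = 0.
    apply/eqP; move/eqP: z2; rewrite !mulf_eq0 (gt_eqF a2p) /= => /orP[|//].
    by rewrite subr_eq0 gt_eqF.
  rewrite subr_eq0 => /eqP vP.
  have /eqP : v *m R1 *m R2 == v *m R1.
    by rewrite relaxed_fixed ?gt_eqF// vP -mulmxA kproj_mul// mulmx0.
  by rewrite vL => <-.
Qed.

Lemma kproj_sub m (A : 'M[R]_(n, m)) :
  (forall v : 'rV[R]_n, v *m AI = 0 -> v *m A = 0) -> P *m kproj A = P.
Proof.
move=> h; apply/row_matrixP => i; rewrite row_mul kproj_id// h// -row_mul.
by rewrite kproj_mul// row0.
Qed.

(** The kernel of [AI] lies in the other two, so P PM = P and P PN = P; transposing these symmetric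
    matrices puts P on the right. *)
Lemma S_T_kproj : L *m P = P.
Proof.
have kP m (A : 'M[R]_(n, m)) : row_full A ->
    (forall v : 'rV[R]_n, v *m AI = 0 -> v *m A = 0) -> kproj A *m P = P.
  by move=> fA h; apply: trmx_inj; rewrite trmx_mul !trmx_kproj// kproj_sub.
have hM : PM *m P = P by apply: kP => // v /kerI[].
have hN : PN *m P = P by apply: kP => // v /kerI[].
have rP a (Q : 'M[R]_n) : Q *m P = P -> ((1 - a)%:M + a *: Q) *m P = P.
  by move=> QP; rewrite mulmxDl mul_scalar_mx -scalemxAl QP -scalerDl subrK scale1r.
by apply: (rP); rewrite -mulmxA !rP.
Qed.

Local Notation B := (L - P).

Lemma transversal_mul_kproj : B *m P = 0.
Proof. by rewrite mulmxBl S_T_kproj kproj_idem// subrr. Qed.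

(** A vector fixed by B is killed by P since B P = 0, hence is fixed by L, hence lies in the range
    of P: it is 0. *)
Lemma transversal_unit : B - 1%:M \in unitmx.
Proof.
rewrite -row_free_unit -kermx_eq0; apply/eqP/row_matrixP => i; rewrite row0.
set u := row i _; have : u *m (B - 1%:M) = 0 by rewrite -row_mul mulmx_ker row0.
rewrite [LHS]mulmxBr mulmx1 => /eqP; rewrite subr_eq0 => /eqP uB.
have uP : u *m P = 0 by rewrite -uB -mulmxA transversal_mul_kproj mulmx0.
have uL : u *m L = u by rewrite -[RHS]uB mulmxBr uP subr0.
by rewrite -(kproj_id (S_T_fixed uL)).
Qed.

Lemma map_Re_mul (w : 'rV[R[i]]_n) (A : 'M[R]_n) :
  map_mx (@complex.Re R) (w *m map_mx (fun a : R => (a%:C)%C) A) =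
  map_mx (@complex.Re R) w *m A.
Proof.
apply/rowP => j; rewrite !mxE.
rewrite (@big_morph _ _ (@complex.Re R) 0 +%R 0 +%R) => [|[a b] [c d]|]//.
by apply: eq_bigr => k _; rewrite !mxE; case: (w 0 k) => a b /=; rewrite mulr0 subr0.
Qed.

Lemma map_Im_mul (w : 'rV[R[i]]_n) (A : 'M[R]_n) :
  map_mx (@complex.Im R) (w *m map_mx (fun a : R => (a%:C)%C) A) =
  map_mx (@complex.Im R) w *m A.
Proof.
apply/rowP => j; rewrite !mxE.
rewrite (@big_morph _ _ (@complex.Im R) 0 +%R 0 +%R) => [|[a b] [c d]|]//.
by apply: eq_bigr => k _; rewrite !mxE; case: (w 0 k) => a b /=; rewrite mulr0 add0r.
Qed.

(** For r nonzero, B P = 0 forces w P = 0, so the eigenvector w of B is one of L. If r = 1, its real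
    and imaginary parts are fixed by L, hence fixed by P, which kills them. *)
Lemma transversal_eigenvalue (r : R[i]) :
  eigenvalue (map_mx (fun a : R => (a%:C)%C) B) r -> Normc.normc r <= gamma L.
Proof.
set cx := fun a : R => _; move=> /eigenvalueP[w wB w0]; apply: gamma_ge.
have [->|r0] := eqVneq r 0; [by left|right].
have mapM (X Y : 'M[R]_n) : map_mx cx (X *m Y) = map_mx cx X *m map_mx cx Y.
  exact: (map_mxM (real_complex R)).
have mapB (X Y : 'M[R]_n) : map_mx cx (X - Y) = map_mx cx X - map_mx cx Y.
  exact: (map_mxB (real_complex R)).
have wP : w *m map_mx cx P = 0.
  apply/eqP; have : r *: (w *m map_mx cx P) == 0.
    rewrite scalemxAl -wB -mulmxA -mapM transversal_mul_kproj.
    by rewrite (map_mx0 (real_complex R)) mulmx0.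
  by rewrite scaler_eq0 (negPf r0).
have wL : w *m map_mx cx L = r *: w.
  by rewrite -wB mapB mulmxBr wP subr0.
split; first by apply/eigenvalueP; exists w.
apply/eqP => r1; move/eqP: w0; apply; rewrite r1 scale1r in wL.
have Re0 : map_mx (@complex.Re R) w = 0.
  rewrite -(@kproj_id _ _ _ AI (map_mx (@complex.Re R) w)); last first.
    by apply: S_T_fixed; rewrite -map_Re_mul wL.
  by rewrite -map_Re_mul wP; apply/rowP => i; rewrite !mxE.
have Im0 : map_mx (@complex.Im R) w = 0.
  rewrite -(@kproj_id _ _ _ AI (map_mx (@complex.Im R) w)); last first.
    by apply: S_T_fixed; rewrite -map_Im_mul wL.
  by rewrite -map_Im_mul wP; apply/rowP => i; rewrite !mxE.
apply/rowP => i; move: Re0 Im0 => /rowP/(_ i) + /rowP/(_ i); rewrite !mxE.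
by case: (w 0 i) => a b /= -> ->.
Qed.

End LinearOperator.

(** * Linear convergence *)

Section GeometricSequences.
Variables (R : realType) (n : nat).

(** Instead of a geometric sum, the induction in [cauchy] carries the closed bound d / (1 - q),
    which reproduces itself since d + q d / (1 - q) = d / (1 - q). Letting the later index tend to
    infinity bounds the error by the step. *)
Lemma contracting_steps (x : nat -> 'rV[R]_n) (xs : 'rV[R]_n) (N : 'rV[R]_n -> R) (q : R) k0 :
  x @ \oo --> xs -> (forall v, `|v| <= N v) -> 0 <= q < 1 ->
  (forall k, (k0 <= k)%N -> N (x k.+2 - x k.+1) <= q * N (x k.+1 - x k)) ->
  forall k, `|x (k0 + k)%N - xs| <= q ^+ k * (N (x k0.+1 - x k0) / (1 - q)).
Proof.
move=> cx normN /andP[q0 q1] step.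
have q10 : 0 < 1 - q by rewrite subr_gt0.
have decay k : N (x (k0 + k).+1 - x (k0 + k)%N) <= q ^+ k * N (x k0.+1 - x k0).
  elim: k => [|k IH]; first by rewrite addn0 expr0 mul1r.
  rewrite addnS exprS -mulrA; apply: le_trans (step _ (leq_addr _ _)) _.
  by rewrite ler_wpM2l.
have cauchy j : forall k, (k0 <= k)%N -> `|x k - x (k + j)%N| <= N (x k.+1 - x k) / (1 - q).
  elim: j => [|j IH] k kk0.
    rewrite addn0 subrr normr0 divr_ge0// ?(ltW q10)//.
    exact: le_trans (normN _).
  have := IH k.+1 (leqW kk0); rewrite addSnnS => h1.
  have h2 := step k kk0.
  have h3 := normN (x k.+1 - x k); rewrite distrC in h3.
  have h4 := ler_distD (x k.+1) (x k) (x (k + j.+1)%N).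
  rewrite ler_pdivlMr//; move: h1; rewrite ler_pdivlMr// => h1.
  have h5 : `|x k - x (k + j.+1)%N| * (1 - q) <=
      (`|x k - x k.+1| + `|x k.+1 - x (k + j.+1)%N|) * (1 - q).
    by rewrite ler_wpM2r// ltW.
  have h6 : `|x k - x k.+1| * (1 - q) <= N (x k.+1 - x k) * (1 - q).
    by rewrite ler_wpM2r// ltW.
  lra.
move=> k; rewrite mulrA; apply: (@le_trans _ _ (N (x (k0 + k).+1 - x (k0 + k)%N) / (1 - q))).
  apply/ler_addgt0Pr => e e0.
  have /cvgrPdist_lt/(_ e e0)[j _ hj] := cx.
  have := hj (k0 + k + j)%N; rewrite /= leq_addl => /(_ isT) /ltW h1.
  have h2 := cauchy j _ (leq_addr k k0).
  rewrite distrC in h1.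
  exact: le_trans (ler_distD (x (k0 + k + j)%N) _ _) (lerD h2 h1).
by rewrite ler_wpM2r// invr_ge0 ltW.
Qed.

(** Absorbs a constant factor into a slightly larger ratio, as (a / b)^j tends to 0. *)
Lemma geometric_dominated (a b C : R) : 0 <= a < b ->
  exists j0 : nat, forall j, (j0 <= j)%N -> a ^+ j * C <= b ^+ j.
Proof.
move=> /andP[a0 ab]; have b0 : 0 < b by exact: le_lt_trans ab.
have ab1 : `|a / b| < 1 by rewrite ger0_norm ?divr_ge0 ?(ltW b0)// ltr_pdivrMr// mul1r.
have C1 : 0 < `|C| + 1 by rewrite ltr_wpDl.
have /cvgrPdist_lt/(_ (`|C| + 1)^-1) := cvg_expr ab1.
rewrite invr_gt0 => /(_ C1)[j0 _ hj]; exists j0 => j jj0.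
have := hj j jj0; rewrite /= sub0r normrN ger0_norm ?exprn_ge0 ?divr_ge0 ?(ltW b0)//.
rewrite expr_div_n ltr_pdivrMr ?exprn_gt0// mulrC ltr_pdivlMr// => h.
have h1 : C <= `|C| by exact: ler_norm.
by apply: le_trans (ltW h); rewrite ler_wpM2l ?exprn_ge0//; lra.
Qed.

End GeometricSequences.

Section LocalRate.
Variables (R : realType) (n : nat).

(* [x k.+1 - x k] is asymptotically [(y - x k) *m (1 - B)] for a fixed point [y] with
   [(x k - y) *m P = 0]; hence its component along [P] is negligible and the
   steps are contracted by [B = L - P] rather than by [L]. *)
Lemma local_linear_rate (Phi : 'rV[R]_n -> set 'rV[R]_n) (xs : 'rV[R]_n)
    (L P : 'M[R]_n) (g mu : R) (x : nat -> 'rV[R]_n) :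
  strictly_diff_at Phi xs L -> (L - P) *m P = 0 -> L - P - 1%:M \in unitmx ->
  (exists2 r : R, 0 < r & exists2 C : R, 0 < C & forall z, `|z - xs| < r ->
     exists y, [/\ Phi y y, (z - y) *m P = 0 & `|y - xs| <= C * `|z - xs|]) ->
  (forall r, eigenvalue (map_mx (fun a : R => (a%:C)%C) (L - P)) r ->
     Normc.normc r <= g) ->
  0 <= g -> g < mu < 1 ->
  (forall k, Phi (x k) (x k.+1)) -> x @ \oo --> xs ->
  exists k0 : nat, forall k, (k0 <= k)%N -> enorm (x k - xs) <= mu ^+ k.
Proof.
set B := L - P => dPhi BP Bunit [r r0 [C C0 fixpt]] eig g0 /andP[gmu mu1] xstep cx.
(* Two intermediate rates: [q1] for the linear part in the adapted norm, [q2] for the actual steps.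
   The gap from [q2] to [mu] pays for constants. *)
pose q1 := (2 * g + mu) / 3; pose q2 := (g + 2 * mu) / 3.
have [gq1 q12 q2mu] : [/\ g < q1, q1 < q2 & q2 < mu] by rewrite /q1 /q2; split; lra.
have [N [ND normN [KN KN0 NK] NB]] := adapted_norm eig gq1.
have [KP KP0 hP] := mulmx_bounded P.
have [KI KI0 hI] := mulmx_bounded (invmx (B - 1%:M)).
(* [N] contracts by [q1] along [B]; the nonlinear remainder costs at most [e * c <= q2 - q1]. *)
pose c := KN * (2 * KP * KI + 1).
have c0 : 0 < c by rewrite mulr_gt0// addr_gt0// !mulr_gt0.
pose e := Num.min ((2 * KI)^-1) ((q2 - q1) / c).
have KI2 : 0 < 2 * KI by rewrite mulr_gt0.
have e0 : 0 < e by rewrite lt_min invr_gt0 KI2 divr_gt0// subr_gt0.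
have eKI : e * (2 * KI) <= 1.
  by rewrite -ler_pdivlMr// mul1r ge_min lexx.
have ec : e * c <= q2 - q1 by rewrite -ler_pdivlMr// ge_min lexx orbT.
clearbody e.
have [s s0 lin] := dPhi e e0.
have C1 : 0 < C + 1 by rewrite addr_gt0.
(* Both x k and the fixed point y, which is only within C t of [xs], must lie in the ball of radius
   s. *)
pose t := Num.min r (s / (C + 1)).
have t0 : 0 < t by rewrite lt_min r0 divr_gt0.
have tr : t <= r by rewrite ge_min lexx.
have ts : t * (C + 1) <= s by rewrite -ler_pdivlMr// ge_min lexx orbT.
clearbody t.
have /cvgrPdist_lt/(_ t t0)[k0 _ near_xs] := cx.
have {}near_xs k : (k0 <= k)%N -> `|x k - xs| < t by rewrite distrC; exact: near_xs.
have ball_s z : `|z - xs| < t -> `|z - xs| < s.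
  move=> zt; apply: lt_le_trans zt (le_trans _ ts); rewrite ler_peMr ?(ltW t0)//; lra.
have step k : (k0 <= k)%N -> N (x k.+2 - x k.+1) <= q2 * N (x k.+1 - x k).
  move=> kk0; have zt := near_xs k kk0; have zt' := near_xs k.+1 (leqW kk0).
  have [y [yy yP yC]] := fixpt _ (lt_le_trans zt tr).
  set z := x k in zt yP yC *; set z' := x k.+1 in zt' *; set dz := z' - z.
  have ys : `|y - xs| < s.
    apply: le_lt_trans yC (lt_le_trans _ ts).
    rewrite mulrDr mulr1 [t * C]mulrC ltr_wpDr ?(ltW t0)// ltr_pM2l//.
  have h1 := lin z y z' y (ball_s _ zt) ys (xstep k) yy.
  set E1 := z' - y - (z - y) *m L in h1.
  have dzE : dz = (z - y) *m (B - 1%:M) + E1.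
    rewrite /E1 mulmxBr mulmx1 mulmxBr yP subr0 /dz.
    by move: ((z - y) *m L) => w; apply/rowP => i; rewrite !mxE; ring.
  (* Inverting B - 1 recovers z - y from the step up to E1; e (2 KI) <= 1 lets half of |z - y|
     absorb E1. *)
  have zy : `|z - y| <= 2 * KI * `|dz|.
    have h2 : `|z - y| <= KI * `|dz - E1|.
      have {1}-> : z - y = (dz - E1) *m invmx (B - 1%:M).
        by rewrite dzE addrK mulmxK.
      exact: hI.
    have h3 := ler_wpM2l (ltW KI0) (ler_normB dz E1).
    have h4 := ler_wpM2l (ltW KI0) h1.
    have h5 : e * (2 * KI) * `|z - y| <= 1 * `|z - y| by rewrite ler_wpM2r.
    lra.
  (* Since (B - 1) P = -P and (z - y) P = 0, only the remainder E1 has a component along P. *)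
  have dzP : `|dz *m P| <= KP * (e * (2 * KI * `|dz|)).
    have -> : dz *m P = E1 *m P.
      have BP1 : (B - 1%:M) *m P = - P by rewrite (mulmxBl B 1%:M) BP mul1mx sub0r.
      rewrite dzE (mulmxDl ((z - y) *m (B - 1%:M))) -(mulmxA (z - y)) BP1.
      by rewrite mulmxN yP oppr0 add0r.
    apply: le_trans (hP _ _) _; rewrite ler_wpM2l ?(ltW KP0)//.
    by apply: le_trans h1 _; rewrite ler_wpM2l ?(ltW e0).
  have h6 := lin z' z (x k.+2) z' (ball_s _ zt') (ball_s _ zt) (xstep k.+1) (xstep k).
  rewrite -/dz in h6; set E2 := x k.+2 - z' - dz *m L in h6.
  have -> : x k.+2 - z' = dz *m B + (dz *m P + E2).
    by rewrite addrA -mulmxDr /B subrK /E2 addrC subrK.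
  apply: le_trans (ND _ _) (le_trans (lerD (NB _) (NK _)) _).
  have h7 : `|dz *m P + E2| <= e * (2 * KP * KI + 1) * N dz.
    apply: le_trans (ler_normD _ _) (le_trans (lerD dzP h6) _).
    rewrite [leLHS](_ : _ = e * (2 * KP * KI + 1) * `|dz|); last by ring.
    by rewrite ler_wpM2l// mulr_ge0 ?(ltW e0)// addr_ge0// !mulr_ge0// ltW.
  have h8 := ler_wpM2l (ltW KN0) h7.
  have N0 : 0 <= N dz by exact: le_trans (normN _).
  have h9 := ler_wpM2r N0 ec.
  by move: h9; rewrite /c; lra.
have q2b : 0 <= q2 < 1 by rewrite /q2; lra.
have bound := contracting_steps cx normN q2b step.
have q2m : 0 <= q2 < mu by rewrite /q2; lra.
have mu0 : 0 < mu by lra.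
set D := N _ / _ in bound.
(* The factor n passes to the Euclidean norm, and dividing by mu^k0 accounts for the index shift k =
   k0 + j. *)
have [j0 dom] := geometric_dominated (n%:R * D / mu ^+ k0) q2m.
exists (k0 + j0)%N => k kk; rewrite -(subnKC (leq_trans (leq_addr _ _) kk)).
set j := (k - k0)%N.
have jj0 : (j0 <= j)%N by rewrite leq_subRL// (leq_trans _ kk)// leq_addr.
apply: le_trans (enorm_mx_norm _) (le_trans (ler_wpM2l _ (bound j)) _) => //.
have := dom j jj0; rewrite mulrA ler_pdivrMr ?exprn_gt0// exprD [mu ^+ k0 * _]mulrC.
by rewrite mulrCA.
Qed.

End LocalRate.

(** * Charts of manifolds and the convergence theorem *)

Section Manifolds.
Variables (R : realType) (n k : nat).
Hypothesis k2 : (2 <= k)%N.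

Lemma local_defining_chart m (M : set 'rV[R]_n) x U (F : 'rV[R]_n -> 'rV[R]_m) :
  local_defining k M x U F ->
  exists d K, regular_chart M x F (fun y => 'J F y) d K.
Proof.
move=> [oU Ux Mx CkF [fJ MUF]].
have [d1 d10 [K K0 quad]] := Ck_second_order k2 oU Ux CkF.
have /nbhs_ballP[d2 /= d20 ballU] : nbhs x U by exact: open_nbhs_nbhs.
exists (Num.min d1 d2), K; split=> //; first by rewrite lt_min d10.
- move=> y; rewrite lt_min => /andP[_ yd2].
  have Uy : U y by apply: ballU; rewrite -ball_normE /= distrC.
  have MUFy : (M `&` U) y <-> U y /\ F y = 0 by rewrite MUF.
  by split=> [My|Fy]; [have [_ ->//] := MUFy.1 (conj My Uy)|
                       have [//] := MUFy.2 (conj Uy Fy)].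
- by move=> a b; rewrite !lt_min => /andP[ad _] /andP[bd _]; have [] := quad a b ad bd.
- by move=> a b; rewrite !lt_min => /andP[ad _] /andP[bd _]; have [] := quad a b ad bd.
Qed.

(** By [kernel_sub], the existential over defining functions in [tangent_space] reduces to the
    kernel for one chosen chart. *)
Lemma manifold_chart (M : set 'rV[R]_n) x : Ck_manifold_around k M x ->
  exists m (F : 'rV[R]_n -> 'rV[R]_m) (J : 'rV[R]_n -> 'M[R]_(n, m)) d K,
    regular_chart M x F J d K /\ tangent_space k M x = [set v | v *m J x = 0].
Proof.
move=> [m [U [F defF]]]; have [d [K chart]] := local_defining_chart defF.
exists m, F, (fun y => 'J F y), d, K; split=> //; apply/seteqP; split=> v /=.
- move=> [m' [U' [F' [defF']]]]; rewrite diff_jacobian => vF'.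
  have [d' [K' chart']] := local_defining_chart defF'.
  exact: (kernel_sub chart' chart).
- by move=> vF; exists m, U, F; rewrite diff_jacobian.
Qed.

End Manifolds.

Theorem theorem7 (R : realType) (n k : nat) (M N : set 'rV[R]_n) (xbar : 'rV[R]_n)
    (alpha alpha1 alpha2 : R) :
  (2 <= k)%N ->
  closed M -> closed N ->
  regular_at k M N xbar ->
  0 < alpha <= 1 -> 0 < alpha1 <= 2 -> 0 < alpha2 <= 2 ->
  ((alpha1 < 2 /\ alpha2 < 2) \/ (alpha < 1 /\ (alpha1 != 2 \/ alpha2 != 2))) ->
  exists2 delta : R, 0 < delta &
    forall (x : nat -> 'rV[R]_n), enorm (x 0%N - xbar) < delta ->
    (forall j, S_op alpha alpha1 alpha2 M N (x j) (x j.+1)) ->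
    forall xstar : 'rV[R]_n, x @ \oo --> xstar ->
    regular_at k M N xstar ->
    forall PM PN : 'M[R]_n,
      is_proj_mx (tangent_space k M xstar) PM ->
      is_proj_mx (tangent_space k N xstar) PN ->
    forall mu : R, gamma (S_T_mx alpha alpha1 alpha2 PM PN) < mu < 1 ->
      exists N0 : nat, forall j, (N0 <= j)%N -> enorm (x j - xstar) <= mu ^+ j.
Proof.
move=> k2 _ _ _ /andP[al0 _] a1b a2b cond; exists 1 => // x _ xS xs cx [mfM mfN mfI tanI].
move=> PM PN isPM isPN mu mub.
have [mM [FM [JM [dM [KM [chM tanM]]]]]] := manifold_chart k2 mfM.
have [mN [FN [JN [dN [KN [chN tanN]]]]]] := manifold_chart k2 mfN.
have [mI [FI [JI [dI [KI [chI tanIE]]]]]] := manifold_chart k2 mfI.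
have [[_ _] [Mx fM] _ _ _] := chM; have [[_ _] [Nx fN] _ _ _] := chN.
have [[_ _] [_ fI] _ _ _] := chI.
have kerI (v : 'rV[R]_n) : v *m JI xs = 0 <-> v *m JM xs = 0 /\ v *m JN xs = 0.
  have -> : (v *m JI xs = 0) = tangent_space k (M `&` N) xs v by rewrite tanIE.
  by rewrite tanI tanM tanN.
(* Either alternative on the parameters excludes two reflections, which is the form [S_T_fixed]
   uses. *)
have a12 : alpha1 < 2 \/ alpha2 < 2.
  have [_ a1le] := andP a1b; have [_ a2le] := andP a2b.
  case: cond => [[]|[_ [ne|ne]]]; [by left|left|right]; by rewrite lt_neqAle ne.
rewrite tanM in isPM; rewrite tanN in isPN.
rewrite (is_proj_mx_kproj fM isPM) (is_proj_mx_kproj fN isPN) in mub *.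
(* This composition is convertible to [S_op], so the rules for strict derivatives apply factor by
   factor. *)
pose Phi := relaxed alpha (set_comp (relaxed alpha2 (proj_set M))
                                    (relaxed alpha1 (proj_set N))).
have Phi_id z : M z -> N z -> Phi z z.
  move=> Mz Nz; apply: relaxed_id; exists z; apply: relaxed_id; exact: proj_set_id.
have dPhi : strictly_diff_at Phi xs
    (S_T_mx alpha alpha1 alpha2 (kproj (JM xs)) (kproj (JN xs))).
  apply: strictly_diff_relaxed; apply: strictly_diff_comp.
  - by apply: relaxed_id; exact: proj_set_id.
  - by apply: strictly_diff_relaxed; exact: (strictly_diff_proj chN).
  - by apply: strictly_diff_relaxed; exact: (strictly_diff_proj chM).
(* Solving in the chart of the intersection gives a fixed point of [Phi], and the correction along
   [lpinv] is orthogonal to the tangent space. *)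
have fixpt : exists2 r : R, 0 < r & exists2 C : R, 0 < C &
    forall z, `|z - xs| < r -> exists y,
      [/\ Phi y y, (z - y) *m kproj (JI xs) = 0 & `|y - xs| <= C * `|z - xs|].
  have [r r0 [C C0 solve]] := solve_equation chI; exists r => //.
  exists (C + 1) => [|z zr]; first by rewrite addr_gt0.
  have [w [[My Ny] _ wC]] := solve z zr.
  exists (z + w *m lpinv (JI xs)); split; first exact: Phi_id.
    by rewrite opprD addrA subrr add0r mulNmx -mulmxA lpinv_kproj// mulmx0 oppr0.
  rewrite addrAC mulrDl mul1r addrC; apply: le_trans (ler_normD _ _) _.
  by rewrite lerD2r.
apply: (local_linear_rate dPhi _ _ fixpt _ _ mub xS cx).
- exact: transversal_mul_kproj.
- exact: (transversal_unit fM fN fI kerI al0 a1b a2b a12).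
- exact: (transversal_eigenvalue fM fN fI kerI al0 a1b a2b a12).
- by rewrite -(Normc.normc0 R); apply: gamma_ge; left.
Qed.
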